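(* Let $n\ge2$ and let $\mathcal C=X_1\cap\dots\cap X_n$ be a tropical complete intersection curve in $\mathbb R^{n+1}$, where $X_i$ is smooth of degree $d_i$ for $i=1,\dots,n$. Then $$\sum_{P\in\mathcal C^{(0)}}m_P=d_1d_2\cdots d_n\,(d_1+d_2+\dots+d_n),$$ where $\mathcal C^{(0)}$ is the set of vertices of $\mathcal C$ and $m_P$ is the intersection multiplicity at $P$.
   Context: Over $(\mathbb R,\max,+)$, a tropical polynomial is $f(x)=\max_{a\in\mathcal A}\{\lambda_a+a\cdot x\}$, $\mathcal A\subseteq\mathbb Z^{m}$ finite, $\lambda_a\in\mathbb R$; Newton polytope $\Delta_f=\operatorname{conv}(\mathcal A)$; lifted polytope $\tilde\Delta_f=\operatorname{conv}\{(a,t):a\in\mathcal A,t\le\lambda_a\}$, whose bounded faces project to a regular lattice subdivision $\operatorname{Subdiv}(f)$ of $\Delta_f$. $V_{tr}(f)$ is the non-linear locus of $f$, a polyhedral complex of pure dimension $m-1$, with a bijection $C\mapsto C^\vee$ from $k$-cells of $V_{tr}(f)$ to $(m-k)$-cells of $\operatorname{Subdiv}(f)$, $C^\vee=\operatorname{conv}\{a:\lambda_a+a\cdot x=f(x)\}$ for $x$ in the relative interior of $C$. $V_{tr}(f)$ is smooth of degree $d$ if every maximal cell of $\operatorname{Subdiv}(f)$ is a lattice simplex of volume $1/m!$ and $\Delta_f=\Gamma^m_d:=\operatorname{conv}\{0,de_1,\dots,de_m\}$. For $X_i=V_{tr}(f_i)$, $i=1,\dots,n$, let $U=X_1\cup\dots\cup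 X_n=V_{tr}(f_1\odot\cdots\odot f_n)$ (the product polynomial has function $f_1+\dots+f_n$), and $\operatorname{Subdiv}_U=\operatorname{Subdiv}(f_1\odot\cdots\odot f_n)$. Since $\tilde\Delta_{f_1\odot\cdots\odot f_n}=\tilde\Delta_{f_1}+\dots+\tilde\Delta_{f_n}$, each bounded face decomposes uniquely as a Minkowski sum of bounded faces of the $\tilde\Delta_{f_i}$; projecting gives the privileged representation $\Lambda=\Lambda_1+\dots+\Lambda_n$ of each cell of $\operatorname{Subdiv}_U$. Each cell $C$ of $X_1\cap\dots\cap X_n$ is uniquely $C_1\cap\dots\cap C_n$ with $C_i$ a cell of $X_i$ containing $C$ in its relative interior; $C$ is a cell of $U$ and $C^\vee\in\operatorname{Subdiv}_U$ has privileged representation $C_1^\vee+\dots+C_n^\vee$. The intersection is transversal if for all $J\subseteq\{1,\dots,n\}$, $|J|\ge2$, $\bigcap_{i\in J}X_i$ has dimension $m-|J|$ and every cell $C$ of it satisfies $\dim C^\vee=\sum_{i\in J}\dim C_i^\vee$ (duals w.r.t. $\bigcup_{i\in J}X_i$). A tropical complete intersection curve is a transversal intersection $\mathcal C=X_1\cap\dots\cap X_n$ of $n\ge2$ smooth tropical hypersurfaces in $\mathbb R^{n+1}$ (so $m=n+1$); it is a one-dimensional polyhedral complex with some unbounded edges. The intersection multiplicity at a vertex $P$ of $\mathcal C$ is $m_P=2\operatorname{vol}_{n+1}(P^\vee)$, with $P^\vee\in\operatorname{Subdiv}_U$. *)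

(* Defs.v *)
From HB Require Import structures.
From mathcomp Require Import all_boot all_order all_algebra.
From mathcomp Require Import all_classical all_reals.
From mathcomp Require Import ereal topology normedtype sequences measure
  lebesgue_measure lebesgue_integral.
Set Implicit Arguments. Unset Strict Implicit. Unset Printing Implicit Defensive.
Import Order.TTheory GRing.Theory Num.Theory.
Local Open Scope classical_set_scope.
Local Open Scope ring_scope.

Section Tropical.
Variable R : realType.

(** Lebesgue volume of a subset of R^k, as the iterated Lebesgue integral of
    its indicator function (Fubini–Tonelli); points of R^k are 'rV[R]_k. *)
Fixpoint vol (k : nat) : set 'rV[R]_k -> \bar R :=
  match k with
  | 0 => fun S => if `[< S 0 >] then 1%E else 0%E
  | k'.+1 => fun S =>
      (\int[@lebesgue_measure R]_(t in setT)
         vol [set y : 'rV[R]_k' | S (row_mx (\row_(j < 1) t) y)])%E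
  end.

Definition toR (m : nat) (a : 'rV[int]_m) : 'rV[R]_m := map_mx (fun z : int => z%:~R) a.

Definition convZ (m : nat) (s : seq 'rV[int]_m) : set 'rV[R]_m :=
  [set x | exists w : 'I_(size s) -> R,
      (forall i, 0 <= w i) /\ \sum_i w i = 1 /\
      x = \sum_i w i *: toR (nth 0 s i)].

Definition affdim (m : nat) (S : set 'rV[R]_m) : nat :=
  \max_(k < m.+1 | `[< exists p : 'I_k.+1 -> 'rV[R]_m,
       (forall i, S (p i)) /\
       \rank (\matrix_(i < k) (p (lift ord0 i) - p ord0)) = k >]) k.

Record tpoly (m : nat) := TPoly { tsupp : seq 'rV[int]_m ; tcoef : 'rV[int]_m -> R }.

Definition maxs (s : seq R) : R := foldr Num.max (head 0 s) s.

Definition dotZ (m : nat) (a : 'rV[int]_m) (x : 'rV[R]_m) : R :=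
  \sum_i (a 0 i)%:~R * x 0 i.

Definition teval (m : nat) (f : tpoly m) (x : 'rV[R]_m) : R :=
  maxs [seq tcoef f a + dotZ a x | a <- tsupp f].

Definition targmax (m : nat) (f : tpoly m) (x : 'rV[R]_m) : seq 'rV[int]_m :=
  [seq a <- tsupp f | tcoef f a + dotZ a x == teval f x].

Definition Vtr (m : nat) (f : tpoly m) : set 'rV[R]_m :=
  [set x | ~ exists e : R, 0 < e /\ exists (v : 'rV[R]_m) (c : R),
      forall y : 'rV[R]_m, (forall i, `|y 0 i - x 0 i| < e) ->
        teval f y = c + \sum_i v 0 i * y 0 i].

(** The cell of Subdiv(f) given by x: projection of the bounded face of the
    lifted polytope selected by x, i.e. conv{a : lambda_a + a.x = f(x)}.
    The cells of Subdiv(f) are exactly the sets [dualcell f x], x in R^m. *)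
Definition dualcell (m : nat) (f : tpoly m) (x : 'rV[R]_m) : set 'rV[R]_m :=
  convZ (targmax f x).

Definition newton (m : nat) (f : tpoly m) : set 'rV[R]_m := convZ (tsupp f).

Definition simplex_pts (m : nat) (d : nat) : seq 'rV[int]_m :=
  0 :: [seq \row_(j < m) (if j == i then d%:Z else 0) | i <- enum 'I_m].

Definition smooth_of_degree (m : nat) (f : tpoly m) (d : nat) : Prop :=
  newton f = convZ (simplex_pts m d) /\
  forall x : 'rV[R]_m,
    (forall y, dualcell f x `<=` dualcell f y -> dualcell f y = dualcell f x) ->
    exists V : seq 'rV[int]_m, size V = m.+1 /\ dualcell f x = convZ V /\
      vol (dualcell f x) = ((m`!)%:R^-1)%:E.

Definition tmul (m : nat) (f g : tpoly m) : tpoly m :=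
  TPoly [seq a + b | a <- tsupp f, b <- tsupp g]
    (fun c => maxs [seq tcoef f p.1 + tcoef g p.2 |
                    p <- [seq (a, b) | a <- tsupp f, b <- tsupp g] & p.1 + p.2 == c]).

Definition tone (m : nat) : tpoly m := TPoly [:: 0] (fun _ => 0).

Definition tprodJ (m n : nat) (fs : 'I_n -> tpoly m) (J : {set 'I_n}) : tpoly m :=
  foldr (@tmul m) (tone m) [seq fs i | i <- enum J].

Definition inter (m n : nat) (fs : 'I_n -> tpoly m) (J : {set 'I_n}) (x : 'rV[R]_m) :=
  forall i, i \in J -> Vtr (fs i) x.

(** the cell C_{i in J} C_i of the intersection containing x in its relative
    interior, where C_i = {y : targmax f_i y contains targmax f_i x} is the
    closed cell of X_i containing x in its relative interior *)
Definition icell (m n : nat) (fs : 'I_n -> tpoly m) (J : {set 'I_n}) (x : 'rV[R]_m)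
  : set 'rV[R]_m :=
  [set y | forall i, i \in J -> {subset targmax (fs i) x <= targmax (fs i) y}].

Definition trop_transversal (m n : nat) (fs : 'I_n -> tpoly m) : Prop :=
  forall J : {set 'I_n}, (2 <= #|J|)%N ->
    ((exists x, inter fs J x /\ affdim (icell fs J x) = (m - #|J|)%N) /\
     (forall x, inter fs J x -> (affdim (icell fs J x) <= m - #|J|)%N)) /\
    (forall x, inter fs J x ->
       affdim (dualcell (tprodJ fs J) x) = (\sum_(i in J) affdim (dualcell (fs i) x))%N).

Definition cvertex (m n : nat) (fs : 'I_n -> tpoly m) (P : 'rV[R]_m) : Prop :=
  inter fs [set: 'I_n]%SET P /\ icell fs [set: 'I_n]%SET P = [set P].

Definition imult (m n : nat) (fs : 'I_n -> tpoly m) (P : 'rV[R]_m) : \bar R :=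
  (2%:E * vol (dualcell (tprodJ fs [set: 'I_n]%SET) P))%E.

End Tropical.

(* Main.v *)
(** A point [p] of the Newton polytope of [f] lies in the cell dual to [x] iff [x]
    minimizes [f - p]. So the cells cover the Newton polytope, two different cells
    meet in a hyperplane, and the volume of the Newton polytope is the sum of the
    volumes of the full-dimensional cells. Apply this to every partial product
    [F_J], [J] a set of indices: its Newton polytope is the simplex of size
    [D_J = \sum_(i in J) d i], of volume [D_J ^ (n+1) / (n+1)!]. By
    transversality, its full-dimensional cells are exactly, up to translation, the
    full-dimensional cells of the whole product at the points [x] such that every
    hypersurface through [x] has its index in [J]. Inclusion-exclusion over [J]
    isolates the points lying on all hypersurfaces, i.e. the vertices of the curve;
    on the other side it produces the [n]-fold iterated difference of [t ^ (n+1)]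
    with steps [d i] at [0], which is [(n+1)! / 2 * \prod d i * \sum d i]. *)
Require Import Defs.
From HB Require Import structures.
From mathcomp Require Import all_boot all_order all_algebra.
From mathcomp Require Import all_classical all_reals.
From mathcomp Require Import ereal topology normedtype sequences measure
  lebesgue_measure lebesgue_integral.
From mathcomp Require Import measurable_realfun derive ftc ring lra.
Import Order.TTheory GRing.Theory Num.Theory.
Import numFieldNormedType.Exports.
Local Open Scope ring_scope.
Local Open Scope classical_set_scope.
Set Implicit Arguments.
Unset Strict Implicit.
Unset Printing Implicit Defensive.

(** * Products of sigma-finite measures *)

Section ProductMeasure.
Context {R : realType} d1 d2 (T1 : measurableType d1) (T2 : measurableType d2).
Variables (m1 : {sigma_finite_measure set T1 -> \bar R})
  (m2 : {sigma_finite_measure set T2 -> \bar R}).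

Lemma sigma_finite_product : sigma_finite setT (m1 \x m2)%E.
Proof.
have /sigma_finiteP[F [TF ndF Foo]] := sigma_finiteT m1.
have /sigma_finiteP[G [TG ndG Goo]] := sigma_finiteT m2.
exists (fun n => F n `*` G n) => [|n].
  apply/seteqP; split => [[x y] _|//].
  have [i _ Fx] : (\bigcup_i F i) x by rewrite -TF.
  have [j _ Gy] : (\bigcup_i G i) y by rewrite -TG.
  exists (maxn i j) => //; split => /=.
    by have /subsetPset := ndF _ _ (leq_maxl i j); apply.
  by have /subsetPset := ndG _ _ (leq_maxr i j); apply.
have [[mF oF] [mG oG]] := (Foo n, Goo n); split; first exact: measurableX.
by rewrite product_measure1E// lte_mul_pinfty// ge0_fin_numE.
Qed.

(* Needed because the canonical sigma-finite structure of [m1 \x m2] is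
   shadowed in the library by the one for subprobabilities. *)
Definition prod_measure : {sigma_finite_measure set (T1 * T2)%type -> \bar R} :=
  HB.pack_for {sigma_finite_measure set (T1 * T2)%type -> \bar R} (m1 \x m2)%E
    (Measure_isSigmaFinite.Build _ _ _ (m1 \x m2)%E sigma_finite_product).

End ProductMeasure.

Definition leb {R : realType} :
    {sigma_finite_measure set (measurableTypeR R) -> \bar R} :=
  @lebesgue_measure R.

(** * Volume in coordinates: null hyperplanes, translations, the corner simplex *)

Section Volume.
Context {R : realType}.

Definition dot m (p u : 'rV[R]_m) : R := \sum_i p 0 i * u 0 i.

(* The library has no product sigma-algebra on ['rV_k]: [vol] is transported along
   [phi] from the iterated product [R * (R * ... * unit)]. *)
Record mspace := MSpace {
  ms_disp : measure_display;
  ms_car : measurableType ms_disp;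
  ms_mu : {sigma_finite_measure set ms_car -> \bar R} }.

Fixpoint msp (k : nat) : mspace :=
  match k with
  | 0 => @MSpace _ _ (@dirac _ unit tt R : {sigma_finite_measure set unit -> \bar R})
  | k'.+1 => @MSpace _ _ (prod_measure leb (ms_mu (msp k')))
  end.

Fixpoint phi (k : nat) : ms_car (msp k) -> 'rV[R]_k :=
  match k with
  | 0 => fun _ => 0
  | k'.+1 => fun z => row_mx (\row_(j < 1) (z.1 : R)) (@phi k' z.2)
  end.

(** A product measure is defined as the integral of the measures of sections, which is exactly the
    recursion of [vol]; this makes the general measure theory available for [vol]. *)
Lemma vol_phi k (S : set 'rV[R]_k) : vol S = ms_mu (msp k) (@phi k @^-1` S).
Proof.
elim: k S => [|k IH] S /=.
  rewrite diracE; case: asboolP => h.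
    by rewrite mem_set.
  by rewrite memNset.
apply: eq_integral => t _ /=.
by rewrite IH /xsection /=; congr (ms_mu _ _); apply/seteqP; split => y /=; rewrite inE.
Qed.

Definition meas k (S : set 'rV[R]_k) := measurable (@phi k @^-1` S).

Lemma measC k (S : set 'rV[R]_k) : meas S -> meas (~` S).
Proof. by move=> h; rewrite /meas preimage_setC; exact: measurableC. Qed.

Lemma measU k (S T : set 'rV[R]_k) : meas S -> meas T -> meas (S `|` T).
Proof. by move=> h g; rewrite /meas preimage_setU; exact: measurableU. Qed.

Lemma measI k (S T : set 'rV[R]_k) : meas S -> meas T -> meas (S `&` T).
Proof. by move=> h g; rewrite /meas preimage_setI; exact: measurableI. Qed.

Lemma meas_bigcap_count k (I : countType) (F : I -> set 'rV[R]_k) :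
  (forall i, meas (F i)) -> meas (\bigcap_i F i).
Proof.
move=> h; rewrite -[X in meas X]setCK; apply: measC; rewrite setC_bigcap.
rewrite /meas preimage_bigcup; apply: countable_bigcupT_measurable => // i.
exact: measC.
Qed.

Lemma meas_set0 k : meas (set0 : set 'rV[R]_k).
Proof. by rewrite /meas preimage_set0. Qed.

Lemma meas_big_setU k (I : Type) (s : seq I) (F : I -> set 'rV[R]_k) :
  (forall i, meas (F i)) -> meas (\big[setU/set0]_(i <- s) F i).
Proof. by move=> h; elim/big_ind: _ => //; [exact: meas_set0|move=> *; exact: measU]. Qed.

Lemma vol_ge0 k (S : set 'rV[R]_k) : (0 <= vol S)%E.
Proof. by rewrite vol_phi. Qed.

Lemma vol_set0 k : vol (set0 : set 'rV[R]_k) = 0%E.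
Proof. by rewrite vol_phi preimage_set0 measure0. Qed.

Lemma le_vol k (S T : set 'rV[R]_k) : meas S -> meas T -> S `<=` T ->
  (vol S <= vol T)%E.
Proof.
by move=> mS mT ST; rewrite !vol_phi le_measure ?inE//; exact: preimage_subset.
Qed.

Lemma vol_split k (S T : set 'rV[R]_k) : meas S -> meas T ->
  vol S = (vol (S `\` T) + vol (S `&` T))%E.
Proof.
by move=> mS mT; rewrite !vol_phi; exact: (measureDI (ms_mu _) mS mT).
Qed.

Lemma volU_null k (S T : set 'rV[R]_k) : meas S -> meas T ->
  vol (S `&` T) = 0%E -> vol (S `|` T) = (vol S + vol T)%E.
Proof.
move=> mS mT h; rewrite (vol_split (measU mS mT) mS).
rewrite setDUl setDv set0U (setIidr (@subsetUl _ S T)).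
by rewrite (vol_split mT mS) (setIC T) h adde0 addeC.
Qed.

Lemma rv_cons0 k (t : R) (y : 'rV[R]_k) :
  (row_mx (\row_(j < 1) t) y : 'rV_k.+1) 0 ord0 = t.
Proof.
rewrite (_ : ord0 = @lshift 1 k 0); last exact: val_inj.
by rewrite (@row_mxEl _ 1 1 k) mxE.
Qed.

Lemma rv_consS k (t : R) (y : 'rV[R]_k) i :
  (row_mx (\row_(j < 1) t) y : 'rV_k.+1) 0 (lift ord0 i) = y 0 i.
Proof.
rewrite (_ : lift ord0 i = @rshift 1 k i); last exact: val_inj.
by rewrite (@row_mxEr _ 1 1 k).
Qed.

Lemma sum_rv_cons k (t : R) (y : 'rV[R]_k) :
  \sum_i (row_mx (\row_(j < 1) t) y : 'rV_k.+1) 0 i = t + \sum_i y 0 i.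
Proof.
rewrite big_ord_recl rv_cons0; congr (_ + _).
by apply: eq_bigr => i _; rewrite rv_consS.
Qed.

Lemma measurable_phi k (i : 'I_k) : measurable_fun setT (fun z => @phi k z 0 i : R).
Proof.
elim: k i => [|k IH] i; first by case: i.
case: (unliftP ord0 i) => [j|] ->; last first.
  apply: (eq_measurable_fun (fst : _ -> R)); last exact: measurable_fst.
  by move=> z _ /=; rewrite rv_cons0.
apply: (eq_measurable_fun ((fun z => @phi k z 0 j : R) \o snd)).
  by move=> z _ /=; rewrite rv_consS.
by apply: measurableT_comp; [exact: IH|exact: measurable_snd].
Qed.

Lemma measurable_dot k (u : 'rV[R]_k) :
  measurable_fun setT (fun z => dot (@phi k z) u).
Proof.
apply: measurable_sum => i; apply: measurable_funM => //.
exact: measurable_phi.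
Qed.

Lemma meas_le k (u : 'rV[R]_k) c : meas [set p | dot p u <= c].
Proof.
rewrite /meas -[X in measurable X]setTI.
have := measurable_dot u measurableT (@measurable_itv R (Interval -oo%O (BRight c))).
congr (measurable _); apply/seteqP; split => z /=; by rewrite in_itv.
Qed.

Lemma meas_eq k (u : 'rV[R]_k) c : meas [set p | dot p u = c].
Proof.
rewrite /meas -[X in measurable X]setTI.
have := measurable_dot u measurableT (measurable_set1 c).
by [].
Qed.

Lemma dot_row_mx k (t : R) (y : 'rV[R]_k) (u : 'rV[R]_k.+1) :
  dot (row_mx (\row_(j < 1) t) y : 'rV_k.+1) u =
  t * u 0 0 + dot y (\row_i u 0 (lift ord0 i)).
Proof.
rewrite /dot big_ord_recl rv_cons0; congr (_ + _).
by apply: eq_bigr => i _; rewrite rv_consS mxE.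
Qed.

(** Induction on the dimension. If the tail [u'] of [u] is nonzero, every slice is a hyperplane one
    dimension lower. Otherwise only the slice at [t = c / u 0 0] can be nonempty, and a single [t]
    does not contribute to the integral. *)
Lemma vol_hyper k (u : 'rV[R]_k) c : u != 0 -> vol [set p | dot p u = c] = 0%E.
Proof.
elim: k u c => [|k IH] u c u0.
  by move: u0; rewrite thinmx0 eqxx.
rewrite /=.
set u' : 'rV_k := \row_i u 0 (lift ord0 i).
have [u'0|u'0] := eqVneq u' 0; last first.
  apply: integral0_eq => t _.
  rewrite -[RHS](IH u' (c - t * u 0 0) u'0); congr vol.
  apply/seteqP; split => y /=; rewrite dot_row_mx -/u'; first by move=> <-; ring.
  by move=> ->; ring.
have u00 : u 0 0 != 0.
  apply: contra_neq u0 => u00; apply/rowP => i; rewrite mxE.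
  case: (unliftP ord0 i) => [j|] ->; last exact: u00.
  by move/rowP : u'0 => /(_ j); rewrite !mxE.
have mm : measurable_fun setT (fun t : R => vol [set y : 'rV_k | dot (row_mx (\row_(j < 1) t) y : 'rV_k.+1) u = c]).
  have h := measurable_fun_xsection (ms_mu (msp k)) (meas_eq u c).
  apply: (eq_measurable_fun _ _ h) => t _ /=.
  rewrite vol_phi /xsection /=; congr (ms_mu _ _).
  by apply/seteqP; split => y /=; rewrite inE.
rewrite (ae_eq_integral (cst 0%E))//; first by rewrite integral0.
exists [set c / u 0 0]; split => //; first exact: lebesgue_measure_set1.
move=> t /= /not_implyP [_ h]; apply: contrapT => tc; apply: h.
rewrite (_ : [set _ | _] = set0) ?vol_set0//; apply/seteqP; split => y //=.
rewrite dot_row_mx -/u' u'0 [dot _ _]big1 ?addr0 => [h|i _]; last by rewrite mxE mulr0.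
by apply: tc; rewrite -h mulfK.
Qed.

(** By uniqueness of Lebesgue measure: its image under a translation gives each half-open interval
    its length. *)
Lemma leb_shift (a : R) (A : set R) : measurable A ->
  lebesgue_measure [set t : R | A (t + a)] = lebesgue_measure A.
Proof.
move=> mA.
have ms : measurable_fun setT (fun t : measurableTypeR R => (t + a : measurableTypeR R)).
  by apply: measurable_funD => //; exact: measurable_id.
pose sh := isMeasurableFun.Build _ _ _ _ _ ms.
pose shf : {mfun _ >-> _} := HB.pack (fun t : measurableTypeR R => (t + a : measurableTypeR R)) sh.
apply/esym; apply: (@lebesgue_measure_unique R (pushforward lebesgue_measure shf)) => //.
move=> X /ocitvP [->|[[x y] /= xy ->]]; first by rewrite !measure0.
rewrite /pushforward /=.
rewrite (_ : _ @^-1` _ = `]x - a, y - a]%classic) ?lebesgue_measure_itv /=.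
  by rewrite !lte_fin ltrD2r; case: ifP => // _; rewrite -!EFinB; congr EFin; ring.
by apply/seteqP; split => t /=; rewrite !in_itv /= ltrBlDr lerBrDr.
Qed.

(** The induction hypothesis absorbs the translation inside each slice; the remaining shift of the
    first coordinate is a change of variable in the outer integral. *)
Lemma vol_shift k (S : set 'rV[R]_k) a : meas S ->
  vol [set p | S (p + a)] = vol S.
Proof.
elim: k S a => [|k IH] S a mS.
  congr vol; apply/seteqP.
  by split => p /=; rewrite (thinmx0 p) (thinmx0 a) addr0.
rewrite [LHS]/=; pose a0 := a 0 ord0; pose a' : 'rV[R]_k := \row_i a 0 (lift ord0 i).
pose sec t : set 'rV[R]_k := [set y | S (row_mx (\row_(j < 1) t) y)].
have msec t : meas (sec t).
  have := measurable_xsection t mS; rewrite /meas /xsection /=.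
  congr (measurable _); by apply/seteqP; split => y /=; rewrite inE.
pose h t : \bar R := vol (sec t).
have mh : measurable_fun setT h.
  apply: (eq_measurable_fun _ _ (measurable_fun_xsection (ms_mu (msp k)) mS)).
  move=> t _ /=; rewrite /h vol_phi /xsection /=; congr (ms_mu _ _).
  by apply/seteqP; split => y /=; rewrite inE.
have hE t : vol [set y | S ((row_mx (\row_(j < 1) t) y : 'rV_k.+1) + a)] = h (t + a0).
  rewrite /h -(IH _ a' (msec _)); congr vol.
  have e y : (row_mx (\row_(j < 1) t) y : 'rV_k.+1) + a =
      row_mx (\row_(j < 1) (t + a0)) (y + a').
    apply/rowP => i; rewrite mxE.
    by case: (unliftP ord0 i) => [j|] ->; rewrite ?rv_consS ?rv_cons0 // !mxE.
  by apply/seteqP; split => y; rewrite /sec /= e.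
under eq_integral do rewrite hE.
pose sh (t : measurableTypeR R) : measurableTypeR R := t + a0.
have ms : measurable_fun setT sh.
  by apply: measurable_funD => //; exact: measurable_id.
rewrite -[LHS](@ge0_integral_pushforward _ _ _ _ _ sh ms lebesgue_measure setT h) //; last first.
  by move=> t _; exact: vol_ge0.
apply: eq_measure_integral => A mA _; exact: leb_shift.
Qed.

(** The slice at [t] is the simplex of size [D - t] one dimension lower if [0 <= t <= D], and empty
    otherwise; so [(D - t)^k / k!] is integrated over [[0, D]]. *)
Lemma vol_simplex k (D : R) : 0 <= D ->
  vol [set p : 'rV[R]_k | (forall i, 0 <= p 0 i) /\ \sum_i p 0 i <= D] =
  (D ^+ k / (k`!)%:R)%:E.
Proof.
elim: k D => [|k IH] D D0.
  rewrite /= asboolT ?expr0 ?fact0 ?divr1//; split => [[]//|].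
  by rewrite big_ord0.
rewrite [LHS]/=.
have vE t : vol [set y : 'rV[R]_k |
    [set p : 'rV[R]_k.+1 | (forall i, 0 <= p 0 i) /\ \sum_i p 0 i <= D]
    (row_mx (\row_(j < 1) t) y)] =
    ((fun t => (((D - t) ^+ k / (k`!)%:R)%:E : \bar R)) \_ `[0, D]) t.
  rewrite patchE; case: ifPn => [|] /=; rewrite mem_setE in_itv /=.
    move=> /andP [t0 tD]; rewrite -IH ?subr_ge0//; congr vol.
    apply/seteqP; split => y /= [h1 h2]; split.
    - by move=> i; move: (h1 (lift ord0 i)); rewrite rv_consS.
    - by move: h2; rewrite (sum_rv_cons t y) lerBrDl.
    - by move=> i; case: (unliftP ord0 i) => [j|] ->; rewrite ?rv_consS ?rv_cons0.
    - by rewrite (sum_rv_cons t y) -lerBrDl.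
  move=> ht; rewrite (_ : [set _ | _] = set0) ?vol_set0//.
  apply/seteqP; split => y //= [h1 h2]; move/negP: ht; apply.
  have t0 := h1 ord0; rewrite rv_cons0 in t0; rewrite t0 /=.
  apply: le_trans h2; rewrite (sum_rv_cons t y) lerDl.
  by apply: sumr_ge0 => i _; move: (h1 (lift ord0 i)); rewrite rv_consS.
under eq_integral do rewrite vE.
rewrite -integral_mkcond.
(* The fundamental theorem of calculus is applied on a nondegenerate interval, so [D = 0] is treated
   apart. *)
move: D0; rewrite le_eqVlt => /predU1P[<-|D0].
  by rewrite set_itv1 integral_set1 expr0n mul0r.
pose c : R := (k.+1`!)%:R.
(* The antiderivative [- (D - t)^(k+1) / (k+1)!], written with function operations so that its
   derivative is inferred. *)
pose F : R -> R := - (cst c^-1 * (cst D - id) ^+ k.+1).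
have dF (t : R) : is_derive t 1 F ((D - t) ^+ k / (k`!)%:R).
  apply: is_derive_eq; rewrite /= /c factS natrM invfM.
  have kf : (k`!%:R : R) != 0 by rewrite pnatr_eq0 -lt0n fact_gt0.
  rewrite scaler0 addr0 sub0r /= !scalerN /GRing.scale /=.
  rewrite !fctE /= opprK mulr1; field.
  by rewrite kf -[1]/(1%:R) -natrD pnatr_eq0.
rewrite (@continuous_FTC2 R _ F)//.
- rewrite /F /c !fctE /= subrr subr0 expr0n mulr0 oppr0 -EFinB sub0r opprK. by rewrite mulrC.
- rewrite (_ : (fun _ => _) = (cst (k`!%:R)^-1 * (cst D - id) ^+ k : R -> R)).
    by apply: derivable_within_continuous => t _; exact: ex_derive.
  by apply/funext => t; rewrite !fctE mulrC.
- split => [t _||]; first exact: ex_derive.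
    by apply: cvg_at_right_filter; apply: differentiable_continuous; apply/derivable1_diffP; exact: ex_derive.
  by apply: cvg_at_left_filter; apply: differentiable_continuous; apply/derivable1_diffP; exact: ex_derive.
- by move=> t _; rewrite derive1E derive_val.
Qed.

End Volume.

(** * The lemma of Farkas and membership in a convex hull *)

Section Convexity.
Context {R : realType}.

Lemma dotDl m (p q u : 'rV[R]_m) : dot (p + q) u = dot p u + dot q u.
Proof. by rewrite /dot -big_split; apply: eq_bigr => i _; rewrite mxE mulrDl. Qed.

Lemma dotZl m a (p u : 'rV[R]_m) : dot (a *: p) u = a * dot p u.
Proof. by rewrite /dot mulr_sumr; apply: eq_bigr => i _; rewrite mxE mulrA. Qed.

Lemma dotC m (p u : 'rV[R]_m) : dot p u = dot u p.
Proof. by apply: eq_bigr => i _; rewrite mulrC. Qed.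

Lemma dotDr m (p q u : 'rV[R]_m) : dot u (p + q) = dot u p + dot u q.
Proof. by rewrite dotC dotDl !(dotC u). Qed.

Lemma dotZr m a (p u : 'rV[R]_m) : dot u (a *: p) = a * dot u p.
Proof. by rewrite dotC dotZl dotC. Qed.

Lemma dotNl m (p u : 'rV[R]_m) : dot (- p) u = - dot p u.
Proof. by rewrite -scaleN1r dotZl mulN1r. Qed.

Lemma dotNr m (p u : 'rV[R]_m) : dot u (- p) = - dot u p.
Proof. by rewrite dotC dotNl dotC. Qed.

Lemma dotBl m (p q u : 'rV[R]_m) : dot (p - q) u = dot p u - dot q u.
Proof. by rewrite dotDl dotNl. Qed.

Lemma dotBr m (p q u : 'rV[R]_m) : dot u (p - q) = dot u p - dot u q.
Proof. by rewrite dotDr dotNr. Qed.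

Lemma dot0l m (u : 'rV[R]_m) : dot 0 u = 0.
Proof. by rewrite -(scale0r 0) dotZl mul0r. Qed.

Lemma dot0r m (u : 'rV[R]_m) : dot u 0 = 0.
Proof. by rewrite dotC dot0l. Qed.

Lemma dot_suml m I (r : seq I) (P : pred I) (F : I -> 'rV[R]_m) u :
  dot (\sum_(i <- r | P i) F i) u = \sum_(i <- r | P i) dot (F i) u.
Proof.
by elim/big_rec2: _ => [|i x y _ <-]; rewrite ?dot0l // dotDl.
Qed.

Lemma dot_delta m (p : 'rV[R]_m) i : dot p (delta_mx 0 i) = p 0 i.
Proof.
rewrite /dot (bigD1 i) //= mxE !eqxx mulr1 big1 ?addr0 // => j ji.
by rewrite mxE (negbTE ji) mulr0.
Qed.

Lemma dotZE m (a : 'rV[int]_m) (x : 'rV[R]_m) : dotZ a x = dot (toR R a) x.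
Proof. by apply: eq_bigr => i _; rewrite mxE. Qed.

(* The pair [(a, b)] codes the linear inequality [dot a x <= b]. *)
Inductive cone m (C : seq ('rV[R]_m * R)) : 'rV[R]_m -> R -> Prop :=
| cone0 : cone C 0 0
| coneS c u a b : 0 <= c -> u \in C -> cone C a b ->
    cone C (c *: u.1 + a) (c * u.2 + b).

Lemma cone_add m (C : seq ('rV[R]_m * R)) a b a' b' :
  cone C a b -> cone C a' b' -> cone C (a + a') (b + b').
Proof.
move=> h h'; elim: h => [|c u x y c0 uC _ IH]; first by rewrite !add0r.
by rewrite -!addrA; apply: coneS.
Qed.

Lemma cone_scale m (C : seq ('rV[R]_m * R)) t a b :
  0 <= t -> cone C a b -> cone C (t *: a) (t * b).
Proof.
move=> t0; elim=> [|c u x y c0 uC _ IH]; first by rewrite scaler0 mulr0; exact: cone0.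
by rewrite scalerDr scalerA mulrDr mulrA; apply: coneS => //; exact: mulr_ge0.
Qed.

Lemma cone_mem m (C : seq ('rV[R]_m * R)) u : u \in C -> cone C u.1 u.2.
Proof.
by move=> uC; have := coneS ler01 uC (cone0 C); rewrite scale1r mul1r !addr0.
Qed.

Lemma cone_trans m (C D : seq ('rV[R]_m * R)) a b :
  (forall u, u \in D -> cone C u.1 u.2) -> cone D a b -> cone C a b.
Proof.
move=> h; elim=> [|c u x y c0 uC _ IH]; first exact: cone0.
by apply: cone_add => //; apply: cone_scale => //; exact: h.
Qed.

(** Collects the successive coefficients into one weight per position; the coefficient of [u] is
    booked at the first index of [u] in [C]. *)
Lemma cone_weights m (C : seq ('rV[R]_m * R)) a b : cone C a b ->
  exists w : nat -> R, (forall i, 0 <= w i) /\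
    a = \sum_(i < size C) w i *: (nth 0 C i).1 /\
    b = \sum_(i < size C) w i * (nth 0 C i).2.
Proof.
elim=> [|c u x y c0 uC _ [w [w0 [-> ->]]]].
  by exists (fun=> 0); split => //; split; rewrite big1 // => i _; rewrite ?scale0r ?mul0r.
have iC : (index u C < size C)%N by rewrite index_mem.
exists (fun i => (if i == index u C then c else 0) + w i); split.
  by move=> i; apply: addr_ge0 => //; case: ifP.
split.
  rewrite [RHS](eq_bigr (fun i : 'I_(size C) =>
      (if (i : nat) == index u C then c else 0) *: (nth 0 C i).1 + w i *: (nth 0 C i).1)).
    rewrite big_split /=; congr (_ + _); rewrite (bigD1 (Ordinal iC)) //= eqxx nth_index // big1 ?addr0 //.
    by move=> i; rewrite -val_eqE /= => /negbTE ->; rewrite scale0r.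
  by move=> i _; rewrite scalerDl.
rewrite [RHS](eq_bigr (fun i : 'I_(size C) =>
    (if (i : nat) == index u C then c else 0) * (nth 0 C i).2 + w i * (nth 0 C i).2)).
  rewrite big_split /=; congr (_ + _); rewrite (bigD1 (Ordinal iC)) //= eqxx nth_index // big1 ?addr0 //.
  by move=> i; rewrite -val_eqE /= => /negbTE ->; rewrite mul0r.
by move=> i _; rewrite mulrDl.
Qed.

(** The one-variable case of the elimination, with lower bounds [L] and upper bounds [U]; either
    list may be empty. *)
Lemma exists_between (L U : seq R) : (forall l u, l \in L -> u \in U -> l <= u) ->
  exists t, (forall l, l \in L -> l <= t) /\ (forall u, u \in U -> t <= u).
Proof.
elim: L => [|x L IH] h.
  elim: U {h} => [|y U [t [_ ht]]]; first by exists 0.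
  exists (Num.min y t); split => // u; rewrite inE => /predU1P[->|uU].
    by rewrite ge_min lexx.
  by rewrite ge_min (ht _ uU) orbT.
have [|t [tL tU]] := IH; first by move=> l u lL uU; apply: h => //; rewrite inE lL orbT.
exists (Num.max x t); split.
  move=> l; rewrite inE => /predU1P[->|lL]; first by rewrite le_max lexx.
  by rewrite le_max (tL _ lL) orbT.
by move=> u uU; rewrite ge_max (tU _ uU) andbT; apply: h => //; rewrite mem_head.
Qed.

(* Fourier-Motzkin elimination, one coordinate at a time. *)
Lemma farkas m (C : seq ('rV[R]_m * R)) :
  (exists x, forall u, u \in C -> dot u.1 x <= u.2) \/
  (exists b, b < 0 /\ cone C 0 b).
Proof.
(* Induction on the number [k] of coordinates that may still occur in the system. *)
suff H k : (k <= m)%N -> forall C : seq ('rV[R]_m * R),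
    (forall u, u \in C -> forall i : 'I_m, (k <= i)%N -> u.1 0 i = 0) ->
    (exists x, forall u, u \in C -> dot u.1 x <= u.2) \/
    (exists b, b < 0 /\ cone C 0 b).
  by apply: (H m) => // u _ i; rewrite leqNgt ltn_ord.
elim: k => [_|k IH km] {}C hC.
  have [[u [uC u0]]|h] := pselect (exists u, u \in C /\ u.2 < 0).
    right; exists u.2; split => //.
    rewrite -(_ : u.1 = 0); first exact: cone_mem.
    by apply/rowP => i; rewrite mxE hC.
  left; exists 0 => u uC; rewrite dot0r leNgt; apply/negP => u0.
  by apply: h; exists u.
pose i0 := Ordinal km.
pose Z := [seq u : 'rV[R]_m * R <- C | u.1 0 i0 == 0].
pose P := [seq u : 'rV[R]_m * R <- C | 0 < u.1 0 i0].
pose N := [seq u : 'rV[R]_m * R <- C | u.1 0 i0 < 0].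
(* For [u] in [P] and [v] in [N] both multipliers are positive, and coordinate [i0] cancels. *)
pose comb (u v : 'rV[R]_m * R) : 'rV[R]_m * R :=
  (u.1 0 i0 *: v.1 + (- v.1 0 i0) *: u.1, u.1 0 i0 * v.2 + (- v.1 0 i0) * u.2).
pose D := Z ++ [seq comb u v | u <- P, v <- N].
have [|[x hx]|[b [b0 hb]]] := IH (ltnW km) D.
- move=> w; rewrite mem_cat => /orP[wZ|/allpairsP[[u v] /= [uP vN ->]]] i ki.
    move: wZ; rewrite mem_filter => /andP[/eqP w0 wC].
    have [->//|ik] := eqVneq i i0; apply: hC => //.
    by rewrite ltn_neqAle ki andbT eq_sym; move: ik; rewrite -val_eqE.
  move: uP vN; rewrite !mem_filter => /andP[u0 uC] /andP[v0 vC].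
  rewrite !mxE; have [->|ik] := eqVneq i i0; first by ring.
  have ki' : (k < i)%N by rewrite ltn_neqAle ki andbT eq_sym; move: ik; rewrite -val_eqE.
  by rewrite (hC u uC i ki') (hC v vC i ki') !mulr0 addr0.
- left.
  (* A solution [x] of the reduced system is corrected by [t] along coordinate [i0]: the constraints
     in [N] bound [t] from below, those in [P] from above. *)
  pose L := [seq (v.2 - dot v.1 x) / v.1 0 i0 | v <- N].
  pose U := [seq (u.2 - dot u.1 x) / u.1 0 i0 | u <- P].
  have [l u|t [tL tU]] := @exists_between L U.
    move=> /mapP[v vN ->] /mapP[{}u uP ->].
    have : dot (comb u v).1 x <= (comb u v).2.
      by apply: hx; rewrite mem_cat allpairs_f ?orbT.
    rewrite /= dotDl !dotZl.
    move: uP vN; rewrite !mem_filter => /andP[u0 _] /andP[v0 _] h.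
    rewrite ler_ndivrMr // mulrAC ler_pdivrMr //; lra.
  exists (x + t *: delta_mx 0 i0) => u uC; rewrite dotDr dotZr dot_delta.
  have [u0|u0|u0] := ltrgtP (u.1 0 i0) 0.
  - have : (u.2 - dot u.1 x) / u.1 0 i0 <= t.
      by apply: tL; apply: map_f; rewrite mem_filter u0.
    by rewrite ler_ndivrMr // ; lra.
  - have : t <= (u.2 - dot u.1 x) / u.1 0 i0.
      by apply: tU; apply: map_f; rewrite mem_filter u0.
    by rewrite ler_pdivlMr //; lra.
  - rewrite u0 mulr0 addr0; apply: hx.
    by rewrite mem_cat mem_filter u0 eqxx uC.
- right; exists b; split => //; apply: cone_trans hb => w.
  rewrite mem_cat => /orP[|/allpairsP[[u v] /= [uP vN ->]]].
    by rewrite mem_filter => /andP[_ wC]; exact: cone_mem.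
  move: uP vN; rewrite !mem_filter => /andP[u0 uC] /andP[v0 vC].
  apply: cone_add; apply: cone_scale; try exact: cone_mem; first exact: ltW.
  by rewrite oppr_ge0 ltW.
Qed.

Lemma convZ_mem m (s : seq 'rV[int]_m) p : convZ s p ->
  exists w : 'I_(size s) -> R, (forall i, 0 <= w i) /\ \sum_i w i = 1 /\
    forall u, dot p u = \sum_i w i * dot (toR R (nth 0 s i)) u.
Proof.
move=> [w [w0 [w1 ->]]]; exists w; split => //; split => // u.
by rewrite dot_suml; apply: eq_bigr => i _; rewrite dotZl.
Qed.

(** Membership by support functions. For the converse, Farkas is applied to the inequalities
    [dot (b - p) x <= -1]: a solution would strictly separate [p] from [s], while an infeasibility
    certificate, once normalized, is a system of convex weights for [p]. *)
Lemma convZP m (s : seq 'rV[int]_m) (p : 'rV[R]_m) :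
  convZ s p <-> forall u, exists2 b, b \in s & dot p u <= dot (toR R b) u.
Proof.
split=> [/convZ_mem[w [w0 [w1 wp]]] u|h].
  apply: contrapT => /forall2NP h.
  have lt i : dot (toR R (nth 0 s i)) u < dot p u \/ (size s <= i)%N.
    have [si|si] := ltnP i (size s); last by right.
    by left; have [/negP|/negP] := h (nth 0 s i); rewrite ?mem_nth // -ltNge.
  have : \sum_i w i * (dot p u - dot (toR R (nth 0 s i)) u) = 0.
    under eq_bigr do rewrite mulrBr.
    by rewrite sumrB -mulr_suml w1 mul1r -wp subrr.
  have wd (i : 'I_(size s)) : 0 <= w i * (dot p u - dot (toR R (nth 0 s i)) u).
    apply: mulr_ge0 => //; have [/ltW|] := lt i; first by rewrite subr_ge0.
    by rewrite leqNgt ltn_ord.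
  move=> /eqP; rewrite psumr_eq0 // => /allP wz.
  have : \sum_i w i = 0.
    rewrite big1 // => i _; have := wz i (mem_index_enum i) => /=.
    rewrite mulf_eq0 => /orP[/eqP//|]; have [|] := lt i; last by rewrite leqNgt ltn_ord.
    by rewrite subr_eq0 => /[swap] /eqP ->; rewrite ltxx.
  by rewrite w1 => /eqP; rewrite oner_eq0.
pose C : seq ('rV[R]_m * R) := [seq (toR R b - p, -1) | b <- s].
have [[x hx]|[b [b0 /cone_weights[w [w0]]]]] := farkas C.
  have [b bs bp] := h x.
  have := hx _ (map_f (fun b => (toR R b - p, -1)) bs).
  by rewrite /= dotBl; lra.
have sC : size C = size s by rewrite size_map.
rewrite sC => -[wa wb].
have nC (i : 'I_(size s)) : nth 0 C i = (toR R (nth 0 s i) - p, -1).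
  by rewrite (nth_map 0).
pose W := \sum_(i < size s) w i.
have W0 : 0 < W.
  rewrite -oppr_lt0 /W -sumrN; apply: le_lt_trans b0; rewrite wb.
  by apply: ler_sum => i _; rewrite nC mulrN1.
exists (fun i => w i / W); split; first by move=> i; apply: divr_ge0 => //; exact: ltW.
split; first by rewrite -mulr_suml divff // gt_eqF.
under eq_bigr do rewrite mulrC -scalerA.
rewrite -scaler_sumr; apply: (scalerI (lt0r_neq0 W0)).
rewrite scalerA divff ?scale1r ?gt_eqF //.
apply/eqP; rewrite -subr_eq0 -oppr_eq0 opprB /W scaler_suml -sumrB [X in _ == X]wa.
apply/eqP; apply: eq_bigr => i _; by rewrite nC scalerBr.
Qed.

End Convexity.

(** * The subdivision dual to a tropical polynomial: covering, overlaps, dimension *)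

Section Subdivision.
Context {R : realType}.

Lemma foldr_max_ge (x0 : R) s a : a \in s -> a <= foldr Num.max x0 s.
Proof.
elim: s => //= b s IH; rewrite inE le_max => /predU1P[->|/IH ->].
  by rewrite lexx.
by rewrite orbT.
Qed.

Lemma maxs_ge (s : seq R) a : a \in s -> a <= maxs s.
Proof. exact: foldr_max_ge. Qed.

Lemma maxs_mem (s : seq R) : s != [::] -> maxs s \in s.
Proof.
move=> s0; have : head 0 s \in s by case: s s0 => // x s _; rewrite mem_head.
rewrite /maxs; move: (head 0 s) => x0 {s0}.
have H (t : seq R) : foldr Num.max x0 t \in x0 :: t.
  elim: t => [|y t IH] /=; first by rewrite mem_head.
  rewrite /Num.max; case: ifP => _; last by rewrite !inE eqxx orbT.
  by move: IH; rewrite !inE => /orP[->|->]; rewrite ?orbT.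
by move=> xs; have := H s; rewrite inE => /predU1P[->|].
Qed.

Definition term m (f : tpoly R m) a x : R := tcoef f a + dot (toR R a) x.

Lemma teval_ge m (f : tpoly R m) a x : a \in tsupp f -> term f a x <= teval f x.
Proof.
move=> aS; apply: maxs_ge; rewrite /term -dotZE.
by apply/mapP; exists a.
Qed.

Lemma targmaxP m (f : tpoly R m) a x :
  (a \in targmax f x) = (a \in tsupp f) && (term f a x == teval f x).
Proof. by rewrite mem_filter andbC dotZE. Qed.

Lemma targmax_ex m (f : tpoly R m) x : tsupp f != [::] ->
  exists a, a \in targmax f x.
Proof.
move=> f0; have /mapP[a aS e] : teval f x \in [seq tcoef f a + dotZ a x | a <- tsupp f].
  by apply: maxs_mem; case: (tsupp f) f0.
by exists a; rewrite targmaxP aS /term -dotZE e eqxx.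
Qed.

Lemma dot_small m (c : 'rV[R]_m) g : 0 < g ->
  exists e, 0 < e /\ forall v : 'rV[R]_m, (forall i, `|v 0 i| < e) -> dot c v < g.
Proof.
move=> g0; pose M := 1 + \sum_i `|c 0 i|.
have M0 : 0 < M by rewrite ltr_pwDl // sumr_ge0.
exists (g / M); split; first exact: divr_gt0.
move=> v hv; apply: (@le_lt_trans _ _ ((M - 1) * (g / M))); last first.
  by rewrite mulrCA gtr_pMr // ltr_pdivrMr //; lra.
rewrite /M addrAC subrr add0r mulr_suml; apply: ler_sum => i _.
apply: le_trans (ler_norm _) _; rewrite normrM; apply: ler_wpM2l => //; exact/ltW.
Qed.

Lemma near_all (I : eqType) m (s : seq I) (Q : I -> 'rV[R]_m -> Prop) :
  (forall a, a \in s -> exists e : R, 0 < e /\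
    forall v : 'rV[R]_m, (forall i, `|v 0 i| < e) -> Q a v) ->
  exists e : R, 0 < e /\ forall v : 'rV[R]_m, (forall i, `|v 0 i| < e) ->
    forall a, a \in s -> Q a v.
Proof.
elim: s => [|b s IH] h; first by exists 1; split.
have [|e [e0 he]] := IH; first by move=> a aS; apply: h; rewrite inE aS orbT.
have [e' [e'0 he']] := h b (mem_head _ _).
exists (Num.min e e'); split; first by rewrite lt_min e0.
move=> v hv a; rewrite inE => /predU1P[->|aS].
  by apply: he' => i; have := hv i; rewrite lt_min => /andP[].
by apply: he => // i; have := hv i; rewrite lt_min => /andP[].
Qed.

(** A term strictly below the maximum at [x] stays below a fixed maximal term [b] under small
    displacements, and there are finitely many terms. *)
Lemma targmax_near m (f : tpoly R m) x : tsupp f != [::] ->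
  exists e : R, 0 < e /\ forall v : 'rV[R]_m, (forall i, `|v 0 i| < e) ->
    {subset targmax f (x + v) <= targmax f x}.
Proof.
move=> f0; have [b] := targmax_ex x f0; rewrite targmaxP => /andP[bS /eqP bx].
have [a aS|e [e0 he]] := @near_all _ m (tsupp f) (fun a v =>
    term f a x = teval f x \/ term f a (x + v) < teval f (x + v)).
  have [ax|/eqP ax] := eqVneq (term f a x) (teval f x).
    by exists 1; split => // v _; left.
  have ltx : term f a x < teval f x by rewrite lt_neqAle teval_ge // andbT; exact/eqP.
  rewrite -subr_gt0 in ltx.
  have [e [e0 he]] := dot_small (toR R a - toR R b) ltx.
  exists e; split => // v /he h; right.
  apply: lt_le_trans (teval_ge _ bS); move: h.
  by rewrite -bx /term !dotDr dotBl; lra.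
exists e; split => // v /he h a; rewrite !targmaxP => /andP[aS /eqP av].
by rewrite aS /=; case: (h a aS) => [->//|]; rewrite av ltxx.
Qed.

Lemma small_scale m (u : 'rV[R]_m) e : 0 < e ->
  exists t, 0 < t /\ forall i, `|(t *: u) 0 i| < e.
Proof.
move=> e0; pose M := 1 + \sum_i `|u 0 i|.
have M0 : 0 < M by rewrite ltr_pwDl // sumr_ge0.
exists (e / M); split; first exact: divr_gt0.
move=> i; rewrite mxE normrM gtr0_norm ?divr_gt0 // mulrAC ltr_pdivrMr // ltr_pM2l //.
by rewrite /M (bigD1 i) //= addrCA ltrDl ltr_pwDl // sumr_ge0.
Qed.

(** The terms active at [x] support the convex function [teval f] from below, so the points of the
    cell are subgradients at [x]. *)
Lemma dualcell_subgrad m (f : tpoly R m) x p y : dualcell f x p ->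
  dot p (y - x) <= teval f y - teval f x.
Proof.
move=> /convZP /(_ (y - x))[b]; rewrite targmaxP => /andP[bS /eqP bx] h.
apply: le_trans h _; rewrite -bx; have := teval_ge y bS.
by rewrite /term dotBr; lra.
Qed.

Lemma dualcell_newton m (f : tpoly R m) x p : dualcell f x p -> newton f p.
Proof.
move=> /convZP h; apply/convZP => u; have [b] := h u.
by rewrite targmaxP => /andP[bS _] hb; exists b.
Qed.

(* A minimizer [x] of [teval f x - dot p x] exists, as the linear system expressing
   minimality is consistent by Farkas; [p] is then a subgradient at [x]. *)
Lemma newton_cover m (f : tpoly R m) p : newton f p -> exists x, dualcell f x p.
Proof.
move=> fp.
have f0 : tsupp f != [::].
  by move/convZP : fp => /(_ 0)[b]; case: (tsupp f).
have [w [w0 [w1 wp]]] := convZ_mem fp.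
pose E := range (fun x => teval f x - dot p x).
have En : E !=set0 by exists (teval f 0 - dot p 0), 0.
(* The convex weights expressing [p], applied to the coefficients of [f], give a lower bound. *)
have lbE : has_lbound E.
  exists (\sum_i w i * tcoef f (nth 0 (tsupp f) i)) => _ [x _ <-].
  rewrite -[teval f x]mul1r -w1 mulr_suml wp -sumrB; apply: ler_sum => i _.
  rewrite -mulrBr; apply: ler_wpM2l => //.
  have := teval_ge x (mem_nth 0 (ltn_ord i)); rewrite /term; lra.
pose mu := inf E.
have muE x : mu <= teval f x - dot p x by apply: ge_inf => //; exists x.
(* A solution [x] of this system satisfies [teval f x - dot p x <= mu], so the infimum [mu] is
   attained at [x]. *)
pose C := [seq (toR R a - p, mu - tcoef f a) | a <- tsupp f].
have [[x hx]|[b [b0 /cone_weights[c [c0]]]]] := farkas C.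
  have minx y : teval f x - dot p x <= teval f y - dot p y.
    apply: le_trans (muE y).
    have [a] := targmax_ex x f0; rewrite targmaxP => /andP[aS /eqP <-].
    have := hx _ (map_f (fun a => (toR R a - p, mu - tcoef f a)) aS).
    by rewrite /term /= dotBl; lra.
  exists x; apply/convZP => u.
  (* A term [b] active at a point slightly beyond [x] in direction [u] is active at [x] too;
     comparing both points with minimality gives [dot p u <= dot b u]. *)
  have [e [e0 he]] := targmax_near x f0.
  have [t [t0 ht]] := small_scale u e0.
  have [b bt] := targmax_ex (x + t *: u) f0.
  have bx := he _ ht _ bt; exists b => //.
  have := minx (x + t *: u); move: bt bx.
  rewrite !targmaxP => /andP[_ /eqP <-] /andP[_ /eqP <-].
  rewrite /term !dotDr !dotZr => h.
  rewrite -(ler_pM2l t0); lra.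
(* The infeasible case: if the total weight [W] is zero then [b = 0]; otherwise [L / W] is a lower
   bound exceeding the infimum [mu]. *)
rewrite size_map => -[ca cb].
have nC (i : 'I_(size (tsupp f))) : nth 0 C i =
    (toR R (nth 0 (tsupp f) i) - p, mu - tcoef f (nth 0 (tsupp f) i)).
  by rewrite (nth_map 0).
pose W := \sum_(i < size (tsupp f)) c i.
pose L := \sum_(i < size (tsupp f)) c i * tcoef f (nth 0 (tsupp f) i).
have bE : b = W * mu - L.
  rewrite cb /W /L mulr_suml -sumrB; apply: eq_bigr => i _.
  by rewrite nC /= mulrBr.
have LW x : L <= W * (teval f x - dot p x).
  have : \sum_(i < size (tsupp f)) c i * (dot (toR R (nth 0 (tsupp f) i)) x - dot p x) = 0.
    rewrite -[RHS](dot0l x) ca dot_suml; apply: eq_bigr => i _.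
    by rewrite dotZl nC /= dotBl.
  move=> z; rewrite -[L]addr0 -z /L /W mulr_suml -big_split /=.
  apply: ler_sum => i _; rewrite -mulrDr; apply: ler_wpM2l => //.
  by have := teval_ge x (mem_nth 0 (ltn_ord i)); rewrite /term; lra.
have W0 : 0 <= W by apply: sumr_ge0.
move: W0; rewrite le_eqVlt => /predU1P[W0|W0].
  have cz (i : 'I_(size (tsupp f))) : c i = 0.
    have /eqP := esym W0; rewrite psumr_eq0 // => /allP /(_ i (mem_index_enum i)) /=.
    by move/eqP.
  by move: b0; rewrite cb big1 ?ltxx // => i _; rewrite cz mul0r.
have : L / W <= mu.
  apply: lb_le_inf => // _ [x _ <-]; rewrite ler_pdivrMr // mulrC; exact: LW.
by rewrite ler_pdivrMr // mulrC => h; move: b0; rewrite bE; lra.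
Qed.

(** Containment in an affine hyperplane. Its negation serves as full-dimensionality: it is easier to
    handle than [affdim], and [affdim_nonflat] relates the two. *)
Definition flat m (S : set 'rV[R]_m) :=
  exists v : 'rV[R]_m, v != 0 /\ exists c, forall p, S p -> dot p v = c.

Lemma convZ_toR m (s : seq 'rV[int]_m) b : b \in s -> convZ s (toR R b).
Proof. by move=> bs; apply/convZP => u; exists b. Qed.

Lemma convZ_dot_const m (s : seq 'rV[int]_m) (v : 'rV[R]_m) c :
  (forall b, b \in s -> dot (toR R b) v = c) -> forall p, convZ s p -> dot p v = c.
Proof.
move=> h p /convZP hp; apply/eqP; rewrite eq_le; apply/andP; split.
  by have [b bs] := hp v; rewrite h.
by have [b bs] := hp (- v); rewrite !dotNr h // lerN2.
Qed.

(** If all terms active at [x] are active at [y], each changes by [teval f y - teval f x], so the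
    cell of [x] lies in a hyperplane normal to [y - x], unless [x = y]. *)
Lemma dualcell_inj m (f : tpoly R m) x y : ~ flat (dualcell f x) ->
  {subset targmax f x <= targmax f y} -> x = y.
Proof.
move=> nf sxy; apply: contrapT => xy; apply: nf.
exists (y - x); split; first by rewrite subr_eq0; apply/eqP => /esym.
exists (teval f y - teval f x); apply: convZ_dot_const => b bx.
move: (bx) (sxy _ bx); rewrite !targmaxP => /andP[_ /eqP <-] /andP[_ /eqP <-].
by rewrite /term dotBr; lra.
Qed.

(** Strict separation from finitely many points survives a small change of direction, so rational
    directions suffice in [convZP] and the hull is a countable intersection. *)
Lemma meas_convZ m (s : seq 'rV[int]_m) : meas (convZ s : set 'rV[R]_m).
Proof.
pose F (q : 'rV[rat]_m) : set 'rV[R]_m :=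
  \big[setU/set0]_(b <- s) [set p | dot p (map_mx ratr q) <= dot (toR R b) (map_mx ratr q)].
rewrite (_ : convZ s = \bigcap_q F q).
  apply: meas_bigcap_count => q; apply: meas_big_setU => b; exact: meas_le.
apply/seteqP; split => p.
  move=> /convZP h q _; rewrite /F -bigcup_seq.
  by have [b bs hb] := h (map_mx ratr q); exists b.
move=> h; apply/convZP => u; apply: contrapT => /forall2NP hu.
have [b bs|e [e0 he]] := @near_all _ m s (fun b v => dot (toR R b) (u + v) < dot p (u + v)).
  have lt : 0 < dot p u - dot (toR R b) u.
    by rewrite subr_gt0 ltNge; apply/negP; have [] := hu b.
  have [e [e0 he]] := dot_small (toR R b - p) lt.
  by exists e; split => // v /he; rewrite dotBl !dotDr; lra.
have /choice[q hq] i : exists q : rat, `|ratr q - u 0 i| < e.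
  have [|q] := @rat_in_itvoo R (u 0 i - e) (u 0 i + e); first by lra.
  rewrite in_itv /= => hq; exists q; rewrite ltr_norml; lra.
have := h (\row_i q i) I; rewrite /F -bigcup_seq => -[b /= bs].
have := he (map_mx ratr (\row_i q i) - u) _ b bs.
rewrite (addrC u) subrK => hb; rewrite leNgt hb // => i.
by rewrite !mxE.
Qed.

Lemma vol_sub_null m (S T : set 'rV[R]_m) : meas S -> meas T -> S `<=` T ->
  vol T = 0%E -> vol S = 0%E.
Proof.
move=> mS mT ST T0; apply/eqP; rewrite eq_le vol_ge0 andbT -T0; exact: le_vol.
Qed.

Lemma vol_big_null m (I : Type) (s : seq I) (F : I -> set 'rV[R]_m) :
  (forall i, meas (F i)) -> (forall i, vol (F i) = 0%E) ->
  vol (\big[setU/set0]_(i <- s) F i) = 0%E.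
Proof.
move=> mF F0; elim: s => [|i s IH]; first by rewrite big_nil vol_set0.
have mb := meas_big_setU s mF.
rewrite big_cons volU_null ?F0 ?IH ?adde0 //.
by apply: (@vol_sub_null _ _ (F i)); [exact: measI|exact: mF|exact: subIsetl|exact: F0].
Qed.

Lemma flat_null m (S : set 'rV[R]_m) : flat S ->
  exists T, meas T /\ vol T = 0%E /\ S `<=` T.
Proof.
move=> [v [v0 [c h]]]; exists [set p | dot p v = c].
by split; [exact: meas_eq|split => //; exact: vol_hyper].
Qed.

(** A common subgradient [p] at [x] and [y] satisfies both inequalities, hence
    [dot p (y - x) = teval f y - teval f x], a hyperplane. *)
Lemma dualcellI_null m (f : tpoly R m) x y : x != y ->
  exists T, meas T /\ vol T = 0%E /\ dualcell f x `&` dualcell f y `<=` T.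
Proof.
move=> xy; apply: flat_null; exists (y - x); split.
  by rewrite subr_eq0 eq_sym.
exists (teval f y - teval f x) => p [px py].
have := dualcell_subgrad y px; have := dualcell_subgrad x py.
rewrite !dotBr => h1 h2; apply/eqP; rewrite eq_le; apply/andP; split; lra.
Qed.

Lemma vol_newton m (f : tpoly R m) (V : seq 'rV[R]_m) : uniq V ->
  (forall x, x \in V <-> ~ flat (dualcell f x)) ->
  vol (newton f) = (\sum_(x <- V) vol (dualcell f x))%E.
Proof.
move=> uV hV; pose U := \big[setU/set0]_(x <- V) dualcell f x.
have mcell x : meas (dualcell f x) by exact: meas_convZ.
have mN : meas (newton f) by exact: meas_convZ.
have mU : meas U by exact: meas_big_setU.
have <- : vol U = (\sum_(x <- V) vol (dualcell f x))%E.
  rewrite /U; elim: (V) uV => [_|x s IH /= /andP[xs us]]; first by rewrite !big_nil vol_set0.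
  rewrite !big_cons -IH // volU_null //; first exact: meas_big_setU.
  have /choice[T hT] y : exists T, meas T /\ vol T = 0%E /\
      (x != y -> dualcell f x `&` dualcell f y `<=` T).
    have [->|xy] := eqVneq x y.
      by exists set0; split; [exact: meas_set0|split => //; exact: vol_set0].
    by have [T [? [? ?]]] := dualcellI_null f xy; exists T.
  have mT y : meas (T y) by have [] := hT y.
  apply: (@vol_sub_null _ _ (\big[setU/set0]_(y <- s) T y)).
  - by apply: measI => //; exact: meas_big_setU.
  - exact: meas_big_setU.
  - move=> p [px]; rewrite -!bigcup_seq => -[y /= ys py]; exists y => //=.
    have [_ [_ h]] := hT y; apply: h => //.
    by apply: contraNneq xs => ->.
  - by apply: vol_big_null => // y; have [_ []] := hT y.
rewrite (vol_split mN mU).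
have -> : newton f `&` U = U.
  apply: setIidr => p; rewrite /U -bigcup_seq => -[x /= _ /dualcell_newton].
  by [].
suff N0 : vol (newton f `\` U) = 0%E by rewrite N0 add0e.
(* Infinitely many points may have flat cells, but each cell is the hull of a masked support; one
   null set per mask covers what [U] misses. *)
pose K := (size (tsupp f)).-tuple bool.
have /choice[T hT] : forall k : K, exists T : set 'rV[R]_m, meas T /\ vol T = 0%E /\
    (flat (convZ (mask k (tsupp f)) : set 'rV[R]_m) -> convZ (mask k (tsupp f)) `<=` T).
  move=> k; have [h|h] := pselect (flat (convZ (mask k (tsupp f)) : set 'rV[R]_m)).
    by have [T [? [? ?]]] := flat_null h; exists T.
  by exists set0; split; [exact: meas_set0|split => //; exact: vol_set0].
have mT k : meas (T k) by have [] := hT k.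
apply: (@vol_sub_null m (newton f `\` U) (\big[setU/set0]_(k <- enum {: K}) T k)).
- by rewrite setDE; apply: measI => //; exact: measC.
- exact: meas_big_setU.
- move=> p [/newton_cover[x px] nU]; rewrite -bigcup_seq.
  have fx : flat (dualcell f x).
    apply: contrapT => /hV xV; apply: nU; rewrite /U -bigcup_seq; by exists x.
  exists [tuple of map (fun a => tcoef f a + dotZ a x == teval f x) (in_tuple (tsupp f))].
    by rewrite /= mem_enum.
  have [_ [_ h]] := hT [tuple of map (fun a => tcoef f a + dotZ a x == teval f x) (in_tuple (tsupp f))].
  by move: h; rewrite /= -filter_mask; apply.
- by apply: vol_big_null => // k; have [_ []] := hT k.
Qed.

Lemma finite_enum (T : eqType) (K : finType) (P : T -> Prop) (g : T -> K) :
  (forall x y, P x -> P y -> g x = g y -> x = y) ->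
  exists V : seq T, uniq V /\ forall x, x \in V <-> P x.
Proof.
move=> ginj.
have /choice[h hh] : forall k : K, exists o : option T,
    if o is Some x then P x /\ g x = k else forall x, P x -> g x <> k.
  move=> k; have [[x [Px gx]]|n] := pselect (exists x, P x /\ g x = k); first by exists (Some x).
  by exists None => x Px gx; apply: n; exists x.
exists (undup (pmap h (enum K))); split; first exact: undup_uniq.
move=> x; rewrite mem_undup mem_pmap; split.
  by move=> /mapP[k _ e]; have := hh k; rewrite -e => -[].
move=> Px; apply/mapP; exists (g x); first by rewrite mem_enum.
have := hh (g x); case: (h (g x)) => [y [Py e]|/(_ x Px)//].
by rewrite (ginj x y).
Qed.

(** A nonflat cell determines its point by the pattern of active terms, and there are finitely many
    patterns. *)
Lemma vertices_finite m (f : tpoly R m) : exists V : seq 'rV[R]_m, uniq V /\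
  forall x, x \in V <-> ~ flat (dualcell f x).
Proof.
apply: (@finite_enum _ _ _ (fun x =>
  [tuple of map (fun a => tcoef f a + dotZ a x == teval f x) (in_tuple (tsupp f))])).
move=> x y fx _ /(congr1 val) /= e; apply: dualcell_inj fx _.
by move=> a; rewrite /targmax !filter_mask e.
Qed.

Lemma affdim_le m (S : set 'rV[R]_m) : (affdim S <= m)%N.
Proof. by apply/bigmax_leqP => k _; rewrite -ltnS. Qed.

Lemma affdim_ge m (S : set 'rV[R]_m) k (p : 'I_k.+1 -> 'rV[R]_m) :
  (forall i, S (p i)) ->
  \rank (\matrix_(i < k) (p (lift ord0 i) - p ord0)) = k -> (k <= affdim S)%N.
Proof.
move=> Sp rk; have km : (k < m.+1)%N by rewrite ltnS -{1}rk rank_leq_col.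
rewrite /affdim (bigD1 (Ordinal km)) /= ?leq_max ?leqnn //.
by apply/asboolP; exists p.
Qed.

Lemma affdim_ge1 m (S : set 'rV[R]_m) p q : S p -> S q -> p != q ->
  (1 <= affdim S)%N.
Proof.
move=> Sp Sq pq.
apply: (@affdim_ge _ _ _ (fun i : 'I_2 => if i == ord0 then p else q)).
  by move=> i; case: ifP.
rewrite (_ : \matrix_(i < 1) _ = q - p); last first.
  by apply/matrixP => i j; rewrite (ord1 i) [LHS]mxE.
by rewrite rank_rV subr_eq0 eq_sym pq.
Qed.

(** If [affdim S < m], a family realizing it has a normal [v != 0]; nonflatness supplies a point [q]
    of [S] off the corresponding hyperplane, and adding [q] raises the rank, against maximality. *)
Lemma affdim_nonflat m (S : set 'rV[R]_m) : S !=set0 -> ~ flat S -> affdim S = m.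
Proof.
move=> [p0 Sp0] nf; apply/eqP; rewrite eqn_leq affdim_le /= leqNgt; apply/negP => km.
pose P k := `[< exists p : 'I_k.+1 -> 'rV[R]_m, (forall i, S (p i)) /\
       \rank (\matrix_(i < k) (p (lift ord0 i) - p ord0)) = k >].
have P0 : P 0%N.
  apply/asboolP; exists (fun=> p0); split => //.
  by apply/eqP; rewrite -leqn0 rank_leq_row.
have [k Pk kE] : exists2 k : 'I_m.+1, P k & affdim S = k.
  have : (0 < #|[pred k : 'I_m.+1 | P k]|)%N by apply/card_gt0P; exists ord0.
  by move=> /(eq_bigmax_cond (fun k : 'I_m.+1 => k : nat))[k]; exists k.
move/asboolP : Pk => [p [Sp rp]]; rewrite kE in km.
set M := \matrix_(i < k) _ in rp.
have /rowV0Pn[v vM v0] : kermx M^T != 0.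
  by rewrite -mxrank_eq0 mxrank_ker mxrank_tr rp -lt0n subn_gt0.
have {}vM : v *m M^T = 0 by apply/sub_kermxP.
have Mv : M *m v^T = 0 by rewrite -[LHS]trmxK trmx_mul trmxK vM trmx0.
have [q Sq qv] : exists2 q, S q & dot (q - p ord0) v != 0.
  apply: contrapT => h; apply: nf; exists v; split => //.
  exists (dot (p ord0) v) => q Sq; apply: contrapT => qv; apply: h; exists q => //.
  by rewrite dotBl subr_eq0; apply/eqP.
(* The new point comes last, which preserves the base point and the earlier differences. *)
pose p' (i : 'I_k.+2) := if unlift ord_max i is Some j then p j else q.
have p'0 : p' ord0 = p ord0.
  by rewrite /p' (_ : ord0 = lift ord_max ord0) ?liftK //; exact: val_inj.
pose M' := \matrix_(i < k.+1) (p' (lift ord0 i) - p' ord0).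
have MM' : (M <= M')%MS.
  apply/row_subP => i.
  rewrite (_ : row i M = row (widen_ord (leqnSn _) i) M') ?row_sub //.
  rewrite !rowK p'0; congr (_ - _).
  rewrite /p' (_ : lift ord0 (widen_ord _ i) = lift ord_max (lift ord0 i)) ?liftK //.
  by apply: val_inj; rewrite /= /bump /= !add1n ltnNge; move: (ltn_ord i) => -> .
have qM' : (q - p ord0 <= M')%MS.
  rewrite (_ : q - p ord0 = row ord_max M') ?row_sub // rowK p'0; congr (_ - _).
  rewrite /p' (_ : lift ord0 ord_max = ord_max) ?unlift_none //.
  exact: val_inj.
have : (k.+1 <= affdim S)%N.
  apply: (@affdim_ge _ _ _ p'); first by move=> i; rewrite /p'; case: unlift.
  apply/eqP; rewrite -/M' eqn_leq rank_leq_row /= ltnNge; apply/negP => rM'.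
  have M'M : (M' <= M)%MS.
    have [_ <-] := mxrank_leqif_sup MM'.
    by rewrite eqn_leq mxrankS //= rp.
  have /submxP[D qD] := submx_trans qM' M'M.
  have : (q - p ord0) *m v^T = 0 by rewrite qD -mulmxA Mv mulmx0.
  move/matrixP => /(_ 0 0); rewrite !mxE => e; move/eqP: qv; apply.
  by rewrite -[RHS]e /dot; apply: eq_bigr => i _; rewrite [v^T _ _]mxE.
by rewrite kE ltnn.
Qed.

End Subdivision.

(** * Iterated differences of powers and inclusion-exclusion *)

Section IteratedDifferences.
Context {R : numFieldType}.

Fixpoint iterdiff (ds : seq R) (g : R -> R) (s : R) : R :=
  if ds is d :: ds' then iterdiff ds' (fun t => g (t + d) - g t) s else g s.

(** Difference operators commute, so the first step may be taken last. *)
Lemma iterdiff_shift ds (g : R -> R) d s :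
  iterdiff (d :: ds) g s = iterdiff ds g (s + d) - iterdiff ds g s.
Proof.
elim: ds g => [//|e ds IH] g; rewrite -(IH (fun t => g (t + e) - g t)) /=.
by congr iterdiff; apply/funext => t; rewrite (addrAC t d e); ring.
Qed.

Lemma iterdiff_sum ds N (c : nat -> R) (g : nat -> R -> R) s :
  iterdiff ds (fun t => \sum_(j < N) c j * g j t) s =
  \sum_(j < N) c j * iterdiff ds (g j) s.
Proof.
elim: ds g => [//|d ds IH] g /=.
rewrite -(IH (fun j t => g j (t + d) - g j t)); congr iterdiff; apply/funext => t.
by rewrite -sumrB; apply: eq_bigr => j _; rewrite mulrBr.
Qed.

(** The binomial expansion of [(t + d)^k], whose leading term cancels against [t^k]. *)
Lemma iterdiff_cons_pow d ds k s : iterdiff (d :: ds) (fun t => t ^+ k) s =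
  \sum_(j < k) ('C(k, j)%:R * d ^+ (k - j)) * iterdiff ds (fun t => t ^+ j) s.
Proof.
rewrite -(iterdiff_sum ds k (fun j => 'C(k, j)%:R * d ^+ (k - j))
  (fun j t => t ^+ j)) /=; congr iterdiff; apply/funext => t.
rewrite (addrC t) exprDn big_ord_recr /= subnn binn expr0 mul1r mulr1n addrK.
by apply: eq_bigr => j _; rewrite -mulr_natl mulrA.
Qed.

Lemma iterdiff_pow_lt ds k s : (k < size ds)%N -> iterdiff ds (fun t => t ^+ k) s = 0.
Proof.
elim: ds k => [//|d ds IH] k kds; rewrite iterdiff_cons_pow big1 // => j _.
by rewrite IH ?mulr0 //; exact: leq_trans (ltn_ord j) kds.
Qed.

Lemma iterdiff_pow_size ds s :
  iterdiff ds (fun t => t ^+ size ds) s = (size ds)`!%:R * \prod_(d <- ds) d.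
Proof.
elim: ds => [|d ds IH]; first by rewrite /= big_nil mulr1.
rewrite iterdiff_cons_pow big_ord_recr /= big1 => [|j _]; last first.
  by rewrite iterdiff_pow_lt ?mulr0.
by rewrite add0r IH binSn subSnn expr1 big_cons factS natrM; ring.
Qed.

(** In the binomial expansion all powers below [size ds] are killed by the remaining differences.
    The two survivors are given by [iterdiff_pow_size] and the induction hypothesis. *)
Lemma iterdiff_pow_sizeS ds s : iterdiff ds (fun t => t ^+ (size ds).+1) s =
  ((size ds).+1)`!%:R / 2 * (\prod_(d <- ds) d) * (2 * s + \sum_(d <- ds) d).
Proof.
elim: ds => [|d ds IH]; first by rewrite /= !big_nil expr1 factS fact0; field.
rewrite iterdiff_cons_pow /= !big_ord_recr /= big1 => [|j _]; last first.
  by rewrite iterdiff_pow_lt ?mulr0.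
rewrite add0r IH iterdiff_pow_size !big_cons binSn subSnn expr1.
set k := size ds.
have C2 : ('C(k.+2, k)%:R * (k`!%:R * 2) : R) = (k.+2)`!%:R.
  have := @bin_fact k.+2 k (leqW (leqnSn _)); rewrite subSn // subSnn => <-.
  by rewrite !natrM.
have F2 : ((k.+2)`!%:R : R) = k.+2%:R * (k.+1)`!%:R by rewrite factS natrM.
rewrite subSn // subSnn.
transitivity (('C(k.+2, k)%:R * (k`!%:R * 2)) / 2 * d ^+ 2 * \prod_(j <- ds) j +
   (k.+2%:R * (k.+1)`!%:R) / 2 * d * (\prod_(j <- ds) j) * (2 * s + \sum_(j <- ds) j)).
  by field.
by rewrite C2 -F2; ring.
Qed.

(** For duplicate-free [l], the alternating sum of [Phi (J :|: K)] over the subsets [K] of [l], with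
    sign [(-1)^(|l| - |K|)]. *)
Fixpoint incl_excl (n : nat) (Phi : {set 'I_n} -> R) (l : seq 'I_n) (J : {set 'I_n}) : R :=
  if l is i :: l' then incl_excl Phi l' (i |: J)%SET - incl_excl Phi l' J else Phi J.

(** Adding a new index [i] to [J] shifts the argument of [g] by [d i]. *)
Lemma incl_excl_iterdiff n (g : R -> R) (d : 'I_n -> R) l (J : {set 'I_n}) :
  uniq l -> (forall i, i \in l -> i \notin J) ->
  incl_excl (fun J => g (\sum_(i in J) d i)) l J =
  iterdiff [seq d i | i <- l] g (\sum_(i in J) d i).
Proof.
elim: l J => [//|i l IH] J /= /andP[il ul] h.
have iJ : i \notin J by apply: h; rewrite mem_head.
have h1 j : j \in l -> j \notin J by move=> jl; apply: h; rewrite inE jl orbT.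
have h2 j : j \in l -> j \notin (i |: J)%SET.
  move=> jl; rewrite !inE negb_or h1 // andbT.
  by apply: contraNneq il => <-.
rewrite -[RHS]/(iterdiff (d i :: [seq d i | i <- l]) g _) iterdiff_shift.
by rewrite !IH // big_setU1 //= (addrC (d i)).
Qed.

Lemma incl_excl_count n (T : Type) (V : seq T) (w : T -> R) (S : T -> {set 'I_n})
    (Phi : {set 'I_n} -> R) l (J : {set 'I_n}) :
  (forall J, Phi J = \sum_(x <- V | S x \subset J) w x) ->
  uniq l -> (forall i, i \in l -> i \notin J) ->
  incl_excl Phi l J =
  \sum_(x <- V | (S x \subset J :|: [set i in l])%SET && ([set i in l]%SET \subset S x)) w x.
Proof.
move=> PhiE; elim: l J => [|i l IH] J /=.
  move=> _ _; rewrite PhiE; apply: eq_bigl => x.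
  rewrite (_ : [set i in [::]]%SET = finset.set0) ?finset.setU0 ?finset.sub0set ?andbT //.
move=> /andP[il ul] h.
have iJ : i \notin J by apply: h; rewrite mem_head.
have h1 j : j \in l -> j \notin J by move=> jl; apply: h; rewrite inE jl orbT.
have h2 j : j \in l -> j \notin (i |: J)%SET.
  move=> jl; rewrite !inE negb_or h1 // andbT.
  by apply: contraNneq il => <-.
rewrite !IH //.
rewrite [X in X - _]big_mkcond [X in _ - X]big_mkcond -sumrB [RHS]big_mkcond.
apply: eq_bigr => x _.
rewrite (_ : (i |: J :|: [set i in l])%SET = (J :|: [set i0 in i :: l])%SET); last first.
  by apply/finset.setP => j; rewrite !inE; case: (j == i); case: (j \in J); case: (j \in l).
rewrite (_ : [set i0 in i :: l]%SET = (i |: [set i in l])%SET); last first.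
  by apply/finset.setP => j; rewrite !inE.
rewrite finset.subUset finset.sub1set.
(* If [i] is in [S x], the subtracted sum does not see [x]; otherwise both sums count [x] alike and
   it cancels. *)
have [iS|iS] /= := boolP (i \in S x).
  rewrite (_ : (S x \subset J :|: [set i in l])%SET = false) ?subr0 //.
  apply/negbTE/negP => /fintype.subsetP /(_ i iS); rewrite !inE (negbTE iJ) /=.
  by rewrite (negbTE il).
rewrite andbF (_ : (S x \subset J :|: (i |: [set i in l]))%SET =
  (S x \subset J :|: [set i in l])%SET) ?subrr //.
apply/fintype.subsetP/fintype.subsetP => hS j jS; move: (hS j jS); rewrite !inE.
  by have [ji|//] := eqVneq j i; move: jS; rewrite ji (negbTE iS).
by move=> /orP[->//|->]; rewrite !orbT.
Qed.

End IteratedDifferences.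

(** * Products of tropical polynomials and Minkowski sums of cells *)

Section Products.
Context {R : realType} {m : nat}.
Implicit Types (f g : tpoly R m) (x : 'rV[R]_m).

Lemma toRD (a b : 'rV[int]_m) : toR R (a + b) = toR R a + toR R b.
Proof. by apply/rowP => i; rewrite !mxE intrD. Qed.

Lemma toR0 : toR R (0 : 'rV[int]_m) = 0.
Proof. by apply/rowP => i; rewrite !mxE. Qed.

Lemma toR_inj : injective (@toR R m).
Proof.
by move=> a b /rowP h; apply/rowP => i; have := h i; rewrite !mxE => /intr_inj.
Qed.

Lemma toR_sum I (r : seq I) (P : pred I) (F : I -> 'rV[int]_m) :
  toR R (\sum_(i <- r | P i) F i) = \sum_(i <- r | P i) toR R (F i).
Proof. by elim/big_rec2: _ => [|i x y _ <-]; rewrite ?toR0 // toRD. Qed.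

Lemma tmul_suppP f g c : (c \in tsupp (tmul f g)) <->
  exists a b, a \in tsupp f /\ b \in tsupp g /\ c = a + b.
Proof.
split=> [/allpairsP[[a b] /= [af bg ->]]|[a [b [af [bg ->]]]]]; first by exists a, b.
exact: allpairs_f.
Qed.

Lemma tmul_coef_ge f g a b : a \in tsupp f -> b \in tsupp g ->
  tcoef f a + tcoef g b <= tcoef (tmul f g) (a + b).
Proof.
move=> af bg; apply: maxs_ge; apply/mapP; exists (a, b) => //.
by rewrite mem_filter eqxx; apply/allpairsP; exists (a, b).
Qed.

Lemma tmul_coef_ex f g c : c \in tsupp (tmul f g) ->
  exists a b, a \in tsupp f /\ b \in tsupp g /\ c = a + b /\
    tcoef (tmul f g) c = tcoef f a + tcoef g b.
Proof.
move=> /tmul_suppP[a [b [af [bg ->]]]].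
have /maxs_mem/mapP : [seq tcoef f p.1 + tcoef g p.2 |
    p <- [seq (a, b) | a <- tsupp f, b <- tsupp g] & p.1 + p.2 == a + b] != [::].
  apply/eqP => /(congr1 size); rewrite size_map => /size0nil e.
  have : (a, b) \in [seq p <- [seq (a, b) | a <- tsupp f, b <- tsupp g] | p.1 + p.2 == a + b].
    by rewrite mem_filter eqxx; apply/allpairsP; exists (a, b).
  by rewrite e.
move=> [[a' b']]; rewrite mem_filter => /andP[/eqP e].
move=> /allpairsP[[u v] /= [uf vg [eu ev]]] h; exists a', b'.
by rewrite eu ev; split => //; split => //; split => //; rewrite -eu -ev.
Qed.

Lemma tmul_supp_n0 f g : tsupp f != [::] -> tsupp g != [::] ->
  tsupp (tmul f g) != [::].
Proof. by rewrite /=; case: (tsupp f) => // a s; case: (tsupp g). Qed.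

Lemma teval_tmul f g x : tsupp f != [::] -> tsupp g != [::] ->
  teval (tmul f g) x = teval f x + teval g x.
Proof.
move=> f0 g0; apply/eqP; rewrite eq_le; apply/andP; split.
  have [c] := targmax_ex x (tmul_supp_n0 f0 g0).
  rewrite targmaxP => /andP[cS /eqP <-].
  have [a [b [af [bg [e ec]]]]] := tmul_coef_ex cS.
  have := teval_ge x af; have := teval_ge x bg.
  by rewrite /term ec e toRD dotDl; lra.
have [a] := targmax_ex x f0; have [b] := targmax_ex x g0.
rewrite !targmaxP => /andP[bS /eqP <-] /andP[aS /eqP <-].
have abS : a + b \in tsupp (tmul f g) by apply/tmul_suppP; exists a, b.
apply: le_trans (teval_ge x abS); rewrite /term toRD dotDl.
have := tmul_coef_ge aS bS; lra.
Qed.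

(** A term of the product reaches [teval f x + teval g x] only if it splits into two terms each
    reaching its own maximum. *)
Lemma targmax_tmul f g x c : tsupp f != [::] -> tsupp g != [::] ->
  (c \in targmax (tmul f g) x) <->
  exists a b, a \in targmax f x /\ b \in targmax g x /\ c = a + b.
Proof.
move=> f0 g0; split.
  rewrite targmaxP teval_tmul // => /andP[cS /eqP cx].
  have [a [b [af [bg [e ec]]]]] := tmul_coef_ex cS; exists a, b.
  have ha := teval_ge x af; have hb := teval_ge x bg.
  move: cx; rewrite {1}/term ec e toRD dotDl => cx.
  split; last split; rewrite ?targmaxP ?af ?bg //=; apply/eqP/le_anti/andP; split => //.
    by move: hb cx; rewrite /term; lra.
  by move: ha cx; rewrite /term; lra.
move=> [a [b []]]; rewrite !targmaxP => /andP[aS /eqP ax] [/andP[bS /eqP bx] ->].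
have abS : a + b \in tsupp (tmul f g) by apply/tmul_suppP; exists a, b.
rewrite abS /= eq_le teval_ge // teval_tmul // -ax -bx /term toRD dotDl.
have := tmul_coef_ge aS bS; lra.
Qed.

Lemma targmax_tone x c : (c \in targmax (tone R m) x) = (c == 0).
Proof.
rewrite targmaxP /= inE andb_idr // => /eqP ->.
have [a] := targmax_ex x (isT : tsupp (tone R m) != [::]).
by rewrite targmaxP /= inE => /andP[/eqP ->].
Qed.

Context {n : nat} (fs : 'I_n -> tpoly R m).
Hypothesis fs0 : forall i, tsupp (fs i) != [::].

(* Both the supports and the argmax sets of products satisfy this recursion. *)
Lemma foldr_sumP (A : 'I_n -> 'rV[int]_m -> Prop) (Q : seq 'I_n -> 'rV[int]_m -> Prop) :
  (forall c, Q [::] c <-> c = 0) ->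
  (forall i l c, Q (i :: l) c <-> exists a b, A i a /\ Q l b /\ c = a + b) ->
  forall l c, uniq l ->
  Q l c <-> exists a, (forall i, i \in l -> A i (a i)) /\ c = \sum_(i <- l) a i.
Proof.
move=> Q0 Q_cons; elim=> [|i l IH] c /=.
  move=> _; rewrite Q0; split => [->|[a [_ ->]]]; last by rewrite big_nil.
  by exists (fun=> 0); rewrite big_nil.
move=> /andP[il ul]; rewrite Q_cons; split.
  move=> [a [b [Aa [/(IH _ ul)[a' [Aa' ->]] ->]]]].
  exists (fun j => if j == i then a else a' j); split.
    move=> j; rewrite inE; have [->//|ji] /= := eqVneq j i; exact: Aa'.
  rewrite big_cons eqxx; congr (_ + _); apply: eq_big_seq => j jl.
  by case: eqVneq => // ji; rewrite -ji jl in il.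
move=> [a [Aa ->]]; exists (a i), (\sum_(j <- l) a j); split.
  by apply: Aa; rewrite mem_head.
split; last by rewrite big_cons.
by apply/IH => //; exists a; split => // j jl; apply: Aa; rewrite inE jl orbT.
Qed.

Lemma tprod_supp_n0 l : tsupp (foldr (@tmul R m) (tone R m) [seq fs i | i <- l]) != [::].
Proof. by elim: l => //= i l IH; exact: tmul_supp_n0. Qed.

Lemma tprod_suppP (J : {set 'I_n}) c : (c \in tsupp (tprodJ fs J)) <->
  exists a, (forall i, i \in J -> a i \in tsupp (fs i)) /\ c = \sum_(i in J) a i.
Proof.
rewrite (@foldr_sumP (fun i a => a \in tsupp (fs i))
  (fun l c => c \in tsupp (foldr (@tmul R m) (tone R m) [seq fs i | i <- l]))) ?enum_uniq //.
- split => -[a [ha ->]]; exists a; rewrite big_enum; split => // i.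
    by move=> iJ; apply: ha; rewrite mem_enum.
  by rewrite mem_enum; exact: ha.
- by move=> c' /=; rewrite inE; split => /eqP.
- by move=> i l c'; exact: tmul_suppP.
Qed.

(** The privileged representation on lattice points: the cell of the product at [x] is the Minkowski
    sum of the cells of the factors at [x]. *)
Lemma targmax_tprodP (J : {set 'I_n}) x c : (c \in targmax (tprodJ fs J) x) <->
  exists a, (forall i, i \in J -> a i \in targmax (fs i) x) /\ c = \sum_(i in J) a i.
Proof.
rewrite (@foldr_sumP (fun i a => a \in targmax (fs i) x)
  (fun l c => c \in targmax (foldr (@tmul R m) (tone R m) [seq fs i | i <- l]) x)) ?enum_uniq //.
- split => -[a [ha ->]]; exists a; rewrite big_enum; split => // i.
    by move=> iJ; apply: ha; rewrite mem_enum.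
  by rewrite mem_enum; exact: ha.
- by move=> c' /=; rewrite targmax_tone; split => /eqP.
- by move=> i l c'; apply: targmax_tmul => //; exact: tprod_supp_n0.
Qed.

(** With one active term, [f] equals it near [x]. If conversely [f] is affine near [x], every active
    term lies below it with equality at [x], hence has the same slope. *)
Lemma VtrP f x : tsupp f != [::] ->
  Vtr f x <-> exists a b, a \in targmax f x /\ b \in targmax f x /\ a != b.
Proof.
move=> f0; split.
  move=> Vx; apply: contrapT => h; apply: Vx.
  have [a ax] := targmax_ex x f0.
  have ua b : b \in targmax f x -> b = a.
    by move=> bx; apply/eqP; apply: contrapT => /negP ba; apply: h; exists b, a.
  have [e [e0 he]] := targmax_near x f0.
  exists e; split => //; exists (toR R a), (tcoef f a) => y hy.
  have [b bt] := targmax_ex (x + (y - x)) f0.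
  have by' : b = a.
    by apply: ua; apply: (he (y - x)) => // i; rewrite !mxE; exact: hy.
  by move: bt; rewrite addrC subrK by' targmaxP => /andP[_ /eqP <-].
move=> [a [b [ax [bx ab]]]] [e [e0 [v [c h]]]].
suff slope a' : a' \in targmax f x -> toR R a' = v.
  by move/eqP: ab; apply; apply: toR_inj; rewrite !slope.
rewrite targmaxP => /andP[aS /eqP a'x].
have tE (u : 'rV[R]_m) t : 0 < t -> (forall i, `|(t *: u) 0 i| < e) ->
    dot (toR R a') u <= dot v u.
  move=> t0 ht.
  have h1 : teval f (x + t *: u) = c + dot v (x + t *: u).
    by apply: h => i; rewrite mxE addrAC subrr add0r.
  have h0 : teval f x = c + dot v x by apply: h => i; rewrite subrr normr0.
  have := teval_ge (x + t *: u) aS; rewrite h1 /term !dotDr !dotZr.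
  move: a'x; rewrite h0 /term => h2 h3; rewrite -(ler_pM2l t0); lra.
apply/rowP => i; rewrite -!dot_delta; apply/le_anti/andP; split.
  by have [t [t0 ht]] := small_scale (delta_mx 0 i : 'rV[R]_m) e0; exact: tE t0 ht.
have [t [t0 ht]] := small_scale (- delta_mx 0 i : 'rV[R]_m) e0.
by have := tE _ _ t0 ht; rewrite !dotNr lerN2.
Qed.

(** Flatness of the Minkowski sum over [J], read factor by factor: one vector [v] is normal to all
    the summands. *)
Definition flatJ (J : {set 'I_n}) x := exists v : 'rV[R]_m, v != 0 /\
  forall i, i \in J -> forall a b, a \in targmax (fs i) x -> b \in targmax (fs i) x ->
    dot (toR R a) v = dot (toR R b) v.

Lemma targmax_sel x : exists s : 'I_n -> 'rV[int]_m, forall i, s i \in targmax (fs i) x.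
Proof.
have /choice[s hs] : forall i, exists a, a \in targmax (fs i) x.
  by move=> i; exact: targmax_ex.
by exists s.
Qed.

(** Varying one summand while the others stay at a fixed selection [s] shows that a functional
    constant on the sum is constant on each summand. *)
Lemma flat_tprod (J : {set 'I_n}) x : flat (dualcell (tprodJ fs J) x) <-> flatJ J x.
Proof.
have [s hs] := targmax_sel x.
split=> -[v [v0 h]]; exists v; split => //.
  move: h => [c h] i iJ a b ax bx.
  have H a' : a' \in targmax (fs i) x ->
      dot (toR R a') v + \sum_(j in J | j != i) dot (toR R (s j)) v = c.
    move=> a'x; pose s' j := if j == i then a' else s j.
    have /h : dualcell (tprodJ fs J) x (toR R (\sum_(j in J) s' j)).
      apply: convZ_toR; apply/targmax_tprodP; exists s'; split => // j jJ.
      by rewrite /s'; case: eqVneq => [->|].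
    rewrite toR_sum dot_suml (bigD1 i) //= {1}/s' eqxx => <-; congr (_ + _).
    by apply: eq_bigr => j /andP[_ /negbTE ji]; rewrite /s' ji.
  by apply: (addIr (\sum_(j in J | j != i) dot (toR R (s j)) v)); rewrite !H.
exists (\sum_(i in J) dot (toR R (s i)) v); apply: convZ_dot_const => b.
move=> /targmax_tprodP[a [ha ->]]; rewrite toR_sum dot_suml.
by apply: eq_bigr => i iJ; apply: (h i) => //; exact: ha.
Qed.

Definition nonlin x : {set 'I_n} := [set i | `[< Vtr (fs i) x >]]%SET.

Lemma targmax_lin x i a b : i \notin nonlin x ->
  a \in targmax (fs i) x -> b \in targmax (fs i) x -> a = b.
Proof.
rewrite inE => /asboolPn nV ax bx; apply/eqP; apply: contrapT => /negP ab.
by apply: nV; apply/VtrP => //; exists a, b.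
Qed.

(** Off its hypersurface a factor has a single active term, so it puts no condition on [v]. *)
Lemma flatJ_nonlin (J : {set 'I_n}) x : flatJ (J :&: nonlin x)%SET x -> flatJ J x.
Proof.
move=> [v [v0 h]]; exists v; split => // i iJ a b ax bx.
have [iN|iN] := boolP (i \in nonlin x); first by apply: (h i) => //; rewrite inE iJ.
by rewrite (targmax_lin iN ax bx).
Qed.

Lemma flatJ_sub (J K : {set 'I_n}) x : K \subset J -> flatJ J x -> flatJ K x.
Proof.
move=> /fintype.subsetP KJ [v [v0 h]]; exists v; split => // i /KJ; exact: h.
Qed.

(** The factors outside [J] contribute single points at [x], so the two cells differ by a
    translation. *)
Lemma vol_tprod_sub (J : {set 'I_n}) x : nonlin x \subset J ->
  vol (dualcell (tprodJ fs J) x) = vol (dualcell (tprodJ fs [set: 'I_n]%SET) x).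
Proof.
move=> NJ; have [s hs] := targmax_sel x.
have sE a : (forall i, a i \in targmax (fs i) x) ->
    \sum_(i in [set: 'I_n]%SET) a i = \sum_(i in J) a i + \sum_(i | i \notin J) s i.
  move=> ha; rewrite (bigID (fun i => i \in J)) /=; congr (_ + _).
    by apply: eq_bigl => i; rewrite inE.
  apply: eq_big => [i|i]; first by rewrite inE.
  move=> iJ; apply: (@targmax_lin x i) => //; rewrite inE /= in iJ.
  by apply: contra iJ; exact: (fintype.subsetP NJ).
rewrite -(@vol_shift R m (dualcell (tprodJ fs [set: 'I_n]%SET) x)
   (toR R (\sum_(i | i \notin J) s i))); last exact: meas_convZ.
congr vol; apply/seteqP; split => p.
  move=> /convZP h; apply/convZP => u; have [b /targmax_tprodP[a [ha ->]] hb] := h u.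
  pose a' i := if i \in J then a i else s i.
  have ha' i : a' i \in targmax (fs i) x by rewrite /a'; case: ifPn => // /ha.
  exists (\sum_(i in [set: 'I_n]%SET) a' i); first by apply/targmax_tprodP; exists a'.
  rewrite sE // toRD !dotDl lerD2r; apply: le_trans hb _.
  by rewrite (eq_bigr a') // => i iJ; rewrite /a' iJ.
move=> /convZP h; apply/convZP => u; have [b /targmax_tprodP[a [ha ->]]] := h u.
have {}ha i : a i \in targmax (fs i) x by apply: ha; rewrite inE.
rewrite sE // toRD !dotDl lerD2r => hb; exists (\sum_(i in J) a i) => //.
by apply/targmax_tprodP; exists a.
Qed.

End Products.

(** * Transversal intersections and the weighted count of vertices *)

Section Intersections.
Context {R : realType} {n : nat}.

Lemma toR_vertex k (d : nat) (i : 'I_k) :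
  toR R (\row_(j < k) (if j == i then d%:Z else 0)) = d%:R *: delta_mx 0 i.
Proof.
apply/rowP => j; rewrite !mxE eqxx /=; case: eqVneq => _; last by rewrite mulr0.
by rewrite mulr1.
Qed.

Lemma simplex_ptsP k d (b : 'rV[int]_k) : b \in simplex_pts k d ->
  (forall i, 0 <= toR R b 0 i) /\ \sum_i toR R b 0 i <= d%:R.
Proof.
rewrite inE => /predU1P[->|/mapP[j _ ->]].
  by rewrite toR0; split => [i|]; rewrite ?mxE // big1 // => i _; rewrite mxE.
rewrite toR_vertex; split => [i|]; first by rewrite !mxE mulr_ge0.
rewrite (bigD1 j) //= !mxE !eqxx mulr1 big1 ?addr0 // => i ij.
by rewrite !mxE (negbTE ij) andbF mulr0.
Qed.

Lemma convZ_corner k (s : seq 'rV[int]_k) (D : R) (p : 'rV[R]_k) :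
  (forall b, b \in s -> (forall i, 0 <= toR R b 0 i) /\ \sum_i toR R b 0 i <= D) ->
  convZ s p -> (forall i, 0 <= p 0 i) /\ \sum_i p 0 i <= D.
Proof.
move=> h /convZP hp; split => [i|].
  have [b /h[b0 _]] := hp (- delta_mx 0 i).
  by rewrite !dotNr !dot_delta lerN2; apply: le_trans.
have [b /h[_ bD]] := hp (const_mx 1).
have dot1 (q : 'rV[R]_k) : dot q (const_mx 1) = \sum_i q 0 i.
  by apply: eq_bigr => i _; rewrite mxE mulr1.
by rewrite !dot1 => /le_trans; apply.
Qed.

(** The maximizing vertex is [0] if no coordinate of [u] is positive, and otherwise the one on the
    axis of the largest coordinate. *)
Lemma corner_max k (d : nat) (p u : 'rV[R]_k.+1) :
  (forall i, 0 <= p 0 i) -> \sum_i p 0 i <= d%:R ->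
  exists2 b, b \in simplex_pts k.+1 d & dot p u <= dot (toR R b) u.
Proof.
move=> p0 pd; have [j _ hj] := @arg_maxP _ R 'I_k.+1 ord0 xpredT (fun i => u 0 i) isT.
have pu : dot p u <= (\sum_i p 0 i) * u 0 j.
  by rewrite mulr_suml; apply: ler_sum => i _; apply: ler_wpM2l => //; exact: hj.
have [uj|uj] := leP (u 0 j) 0.
  exists 0; first by rewrite mem_head.
  rewrite toR0 dot0l; apply: le_trans pu _; apply: mulr_ge0_le0 => //; exact: sumr_ge0.
exists (\row_(i < k.+1) (if i == j then d%:Z else 0)).
  by rewrite inE map_f ?orbT // mem_enum.
rewrite toR_vertex dotZl (dotC (delta_mx _ _)) dot_delta; apply: le_trans pu _.
by rewrite ler_pM2r.
Qed.

Variable fs : 'I_n -> tpoly R n.+1.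
Variable d : 'I_n -> nat.
Hypothesis newton_fs : forall i, newton (fs i) = convZ (simplex_pts n.+1 (d i)).

Lemma supp_max i b u : b \in simplex_pts n.+1 (d i) ->
  exists2 a, a \in tsupp (fs i) & dot (toR R b) u <= dot (toR R a) u.
Proof. by move=> /(@convZ_toR R); rewrite -newton_fs => /convZP /(_ u). Qed.

Lemma fs_n0 i : tsupp (fs i) != [::].
Proof. by have [a] := @supp_max i 0 0 (mem_head _ _); case: tsupp. Qed.

Lemma supp_corner i a : a \in tsupp (fs i) ->
  (forall j, 0 <= toR R a 0 j) /\ \sum_j toR R a 0 j <= (d i)%:R.
Proof.
move=> /(@convZ_toR R); rewrite -[convZ _]/(newton _) newton_fs.
by apply: convZ_corner => b; exact: simplex_ptsP.
Qed.

(** Corner simplices add up under Minkowski sum: for a given [u], the same kind of vertex is maximal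
    in every factor, and [sel] replaces these vertices by exponents of the supports that are at
    least as good. *)
Lemma newton_tprod (J : {set 'I_n}) : newton (tprodJ fs J) =
  [set p | (forall i, 0 <= p 0 i) /\ \sum_i p 0 i <= (\sum_(i in J) d i)%:R].
Proof.
apply/seteqP; split => p.
  apply: convZ_corner => b /(tprod_suppP fs)[a [ha ->]].
  rewrite toR_sum; split => [j|].
    by rewrite summxE; apply: sumr_ge0 => i iJ; have [] := supp_corner (ha i iJ).
  rewrite (eq_bigr (fun j => \sum_(i in J) toR R (a i) 0 j)) => [|j _]; last first.
    by rewrite summxE.
  rewrite exchange_big natr_sum; apply: ler_sum => i iJ.
  by have [] := supp_corner (ha i iJ).
move=> [p0 pD]; apply/convZP => u.
have [b] := corner_max u p0 pD.
have sel (b' : 'I_n -> 'rV[int]_n.+1) : (forall i, b' i \in simplex_pts n.+1 (d i)) ->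
    exists2 c, c \in tsupp (tprodJ fs J) &
      \sum_(i in J) dot (toR R (b' i)) u <= dot (toR R c) u.
  move=> hb'; have /choice[a ha] : forall i, exists a, a \in tsupp (fs i) /\
      dot (toR R (b' i)) u <= dot (toR R a) u.
    by move=> i; have [a] := supp_max u (hb' i); exists a.
  exists (\sum_(i in J) a i).
    by apply/(tprod_suppP fs); exists a; split => // i _; have [] := ha i.
  rewrite toR_sum dot_suml; apply: ler_sum => i _; by have [] := ha i.
rewrite inE => /predU1P[->|/mapP[j _ ->]] h.
  have [c cS hc] := sel (fun=> 0) (fun=> mem_head _ _); exists c => //.
  apply: le_trans h (le_trans _ hc); by rewrite big1 ?toR0 ?dot0l.
have [|c cS hc] := sel (fun i => \row_(k < n.+1) (if k == j then (d i)%:Z else 0)).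
  by move=> i; rewrite inE map_f ?orbT // mem_enum.
exists c => //; apply: le_trans h (le_trans _ hc).
rewrite toR_vertex dotZl natr_sum mulr_suml.
by apply: ler_sum => i _; rewrite toR_vertex dotZl.
Qed.

Lemma flatJ0 (x : 'rV[R]_n.+1) : flatJ fs finset.set0 x.
Proof.
exists (const_mx 1); split; last by move=> i; rewrite inE.
by apply/eqP => /rowP /(_ ord0); rewrite !mxE => /eqP; rewrite oner_eq0.
Qed.

Hypothesis trans : trop_transversal fs.

Lemma affdim_dualcell1 i x : i \in nonlin fs x ->
  (1 <= affdim (dualcell (fs i) x))%N.
Proof.
rewrite inE => /asboolP /(VtrP _ (fs_n0 i))[a [b [ax [bx ab]]]].
apply: (@affdim_ge1 _ _ _ (toR R a) (toR R b)); [exact: convZ_toR..|].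
by rewrite (inj_eq (@toR_inj R _)).
Qed.

Lemma inter_nonlin (J : {set 'I_n}) x : J \subset nonlin fs x -> inter fs J x.
Proof. by move=> /fintype.subsetP h i /h; rewrite inE => /asboolP. Qed.

(** Transversality applies from two indices on; for one index the cell itself is full-dimensional,
    and the empty sum is flat. *)
Lemma affdim_sum (J : {set 'I_n}) x : J \subset nonlin fs x -> ~ flatJ fs J x ->
  (\sum_(i in J) affdim (dualcell (fs i) x))%N = n.+1.
Proof.
move=> JN nf.
have ne (f : tpoly R n.+1) : tsupp f != [::] -> dualcell f x !=set0.
  by move=> /(targmax_ex x)[a ax]; exists (toR R a); exact: convZ_toR.
have [J2|] := leqP 2 #|J|.
  have [_ /(_ x (inter_nonlin JN)) <-] := trans J2.
  apply: affdim_nonflat; first by apply: ne; exact: tprod_supp_n0 fs_n0 _.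
  by move=> /(flat_tprod fs_n0).
rewrite ltnS leq_eqVlt ltnS leqn0 => /orP[/cards1P[i JE]|]; last first.
  by rewrite cards_eq0 => /eqP JE; case: nf; rewrite JE; exact: flatJ0.
rewrite JE big_set1; apply: affdim_nonflat; first exact: ne (fs_n0 i).
move=> [v [v0 [c h]]]; apply: nf; rewrite JE; exists v; split => // j.
by rewrite inE => /eqP -> a b ax bx; rewrite !h //; exact: convZ_toR.
Qed.

(** The factors in [J] already use up all [n+1] dimensions. A further hypersurface through [x] would
    add a cell of dimension at least one, and by transversality the total would be the dimension of
    a set in [n+1]-space. *)
Lemma nonflat_nonlin_sub (J : {set 'I_n}) x : ~ flatJ fs J x -> nonlin fs x \subset J.
Proof.
move=> nf; apply/fintype.subsetP => i iN; apply: contrapT => /negP iJ.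
set N := nonlin fs x in iN; set J0 := (J :&: N)%SET.
have nf0 : ~ flatJ fs J0 x by move=> /(flatJ_nonlin fs_n0).
have J0N : J0 \subset N by exact: finset.subsetIr.
have iJ0 : i \notin J0 by rewrite inE (negbTE iJ).
have e0 := affdim_sum J0N nf0.
have N2 : (2 <= #|N|)%N.
  have J0p : (0 < #|J0|)%N.
    rewrite lt0n cards_eq0; apply/eqP => J00; apply: nf0; rewrite J00; exact: flatJ0.
  apply: (@leq_trans #|(i |: J0)%SET|); first by rewrite cardsU1 iJ0.
  by apply: subset_leq_card; rewrite finset.subUset finset.sub1set iN.
have [_ /(_ x (inter_nonlin (fintype.subxx N))) e] := trans N2.
suff : (\sum_(j in J0) affdim (dualcell (fs j) x) <
    \sum_(j in N) affdim (dualcell (fs j) x))%N by rewrite e0 -e ltnNge affdim_le.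
rewrite [ltnRHS](bigID (fun j => j \in J0)) /=.
rewrite [X in (_ < X + _)%N](eq_bigl (fun j => j \in J0)) => [|j]; last first.
  by apply: andb_idl => /(fintype.subsetP J0N).
rewrite -addn1 leq_add2l (bigD1 i) ?iN //=.
by rewrite ltn_addr // affdim_dualcell1.
Qed.

Lemma nonflatP (J : {set 'I_n}) x : ~ flat (dualcell (tprodJ fs J) x) <->
  ~ flat (dualcell (tprodJ fs [set: 'I_n]%SET) x) /\ nonlin fs x \subset J.
Proof.
rewrite !(flat_tprod fs_n0); split => [nf|[nf NJ] fJ].
  split; last exact: nonflat_nonlin_sub.
  by move=> /flatJ_sub h; apply: nf; apply: h; exact: finset.subsetT.
apply: nf; apply: (flatJ_nonlin fs_n0); apply: flatJ_sub fJ.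
by rewrite finset.setTI.
Qed.

(** A vector normal to all the cells at [P] allows a move inside the cell of the intersection;
    conversely a second point [y] of that cell makes [y - P] such a normal. *)
Lemma cvertexP P : cvertex fs P <->
  ~ flat (dualcell (tprodJ fs [set: 'I_n]%SET) P) /\ nonlin fs P = [set: 'I_n]%SET.
Proof.
rewrite (flat_tprod fs_n0); split => [[iP cP]|[nf NP]].
  split; last by apply/finset.setP => i; rewrite !inE; apply/asboolP; apply: iP; rewrite inE.
  move=> [v [v0 h]].
  have [i _|e [e0 he]] := @near_all R _ _ (enum 'I_n) (fun i w =>
      {subset targmax (fs i) (P + w) <= targmax (fs i) P}).
    exact: targmax_near (fs_n0 i).
  have [t [t0 ht]] := small_scale v e0.
  (* All terms of [fs i] active at [P] change equally along [v], and for small [t] no other term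
     becomes active. *)
  have : icell fs [set: 'I_n]%SET P (P + t *: v).
    move=> i _ a aP; have [b bt] := targmax_ex (P + t *: v) (fs_n0 i).
    have bP := he _ ht i (mem_enum _ i) b bt.
    have := h i (finset.in_setT i) a b aP bP.
    move: aP bP bt; rewrite !targmaxP => /andP[-> /eqP aP] /andP[_ /eqP bP] /andP[_ /eqP <-].
    rewrite /term !dotDr !dotZr => ->; apply/eqP.
    by move: aP; rewrite -bP /term; lra.
  rewrite cP => /= /eqP; rewrite -subr_eq0 addrAC subrr add0r scaler_eq0 (negbTE v0) orbF.
  by rewrite gt_eqF.
split; first by apply: inter_nonlin; rewrite NP.
apply/seteqP; split => y; last by move=> -> i _.
move=> hy; apply: contrapT => yP; apply: nf; exists (y - P); split.
  by rewrite subr_eq0; apply/eqP.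
have slope i a : a \in targmax (fs i) P ->
    dot (toR R a) (y - P) = teval (fs i) y - teval (fs i) P.
  move=> aP; move: (hy i (finset.in_setT i) a aP) (aP).
  by rewrite !targmaxP => /andP[_ /eqP <-] /andP[_ /eqP <-]; rewrite /term dotBr; lra.
by move=> i _ a b aP bP; rewrite (slope i a) // (slope i b).
Qed.

Lemma vol_newton_tprod (J : {set 'I_n}) : vol (newton (tprodJ fs J)) =
  ((\sum_(i in J) (d i)%:R) ^+ n.+1 / (n.+1)`!%:R)%:E.
Proof. by rewrite newton_tprod vol_simplex // natr_sum. Qed.

Lemma vol_dualcell_fin (f : tpoly R n.+1) x : (vol (newton f) < +oo)%E ->
  vol (dualcell f x) \is a fin_num.
Proof.
move=> h; rewrite ge0_fin_numE ?vol_ge0 //; apply: le_lt_trans h.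
by apply: le_vol; [exact: meas_convZ..|exact: dualcell_newton].
Qed.

Lemma sum_imult : exists vs : seq 'rV[R]_n.+1,
  uniq vs /\ (forall P, P \in vs <-> cvertex fs P) /\
  (\sum_(P <- vs) imult fs P)%E = (((\prod_(i < n) d i) * (\sum_(i < n) d i))%N%:R)%:E.
Proof.
pose F := tprodJ fs [set: 'I_n]%SET.
have [V [uV hV]] := vertices_finite F.
exists [seq x <- V | nonlin fs x == [set: 'I_n]%SET]; split; first exact: filter_uniq.
split.
  move=> P; rewrite mem_filter cvertexP -hV; split => [/andP[/eqP -> ->]//|[-> ->]].
  by rewrite eqxx.
pose w x := fine (vol (dualcell F x)).
have wE x : vol (dualcell F x) = (w x)%:E.
  by rewrite /w fineK // vol_dualcell_fin // /F vol_newton_tprod ltry.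
(* The volume of the Newton polytope of the partial product, computed as a simplex and as a sum over
   cells, with the factorial cleared. *)
have volJ (J : {set 'I_n}) : (\sum_(i in J) (d i)%:R) ^+ n.+1 =
    \sum_(x <- V | nonlin fs x \subset J) (n.+1)`!%:R * w x.
  have fac0 : ((n.+1)`!%:R : R) != 0 by rewrite pnatr_eq0 -lt0n fact_gt0.
  have := vol_newton_tprod J.
  rewrite (@vol_newton _ _ _ [seq x <- V | nonlin fs x \subset J]) ?filter_uniq //; last first.
    move=> x; rewrite mem_filter nonflatP -hV; split => [/andP[-> ->]//|[-> ->]//].
  rewrite big_filter (eq_bigr (fun x => (w x)%:E)) => [|x NJ]; last first.
    by rewrite -wE (vol_tprod_sub fs_n0).
  rewrite sumEFin => -[e]; rewrite -mulr_sumr e mulrC divfK //.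
have h0 (i : 'I_n) : i \in enum 'I_n -> i \notin finset.set0 by rewrite inE.
(* Starting from the empty set and running through all indices keeps exactly the points of [V] on
   every hypersurface. *)
have := incl_excl_count volJ (enum_uniq 'I_n) h0.
rewrite (@incl_excl_iterdiff _ _ (fun t => t ^+ n.+1)) ?enum_uniq //.
rewrite big_set0; have sz : size [seq ((d i)%:R : R) | i <- enum 'I_n] = n.
  by rewrite size_map size_enum_ord.
(* The exponent is one more than the number [n] of steps; at [s = 0] the formula leaves the product
   times the sum of the degrees. *)
have -> : (fun t : R => t ^+ n.+1) =
    (fun t => t ^+ (size [seq ((d i)%:R : R) | i <- enum 'I_n]).+1) by rewrite sz.
rewrite iterdiff_pow_sizeS sz !big_map -enumT !big_enum /= mulr0 add0r.
rewrite (eq_bigl (fun x => nonlin fs x == [set: 'I_n]%SET)) => [|x]; last first.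
  rewrite (_ : [set i in _]%SET = [set: 'I_n]%SET); last first.
    by apply/finset.setP => i; rewrite !inE mem_enum.
  by rewrite finset.set0U finset.subsetT finset.subTset.
move=> e; rewrite big_filter (eq_bigr (fun x => (2 * w x)%:E)) => [|x _]; last first.
  by rewrite /imult wE.
rewrite sumEFin; congr EFin; rewrite -mulr_sumr.
have fac0 : ((n.+1)`!%:R : R) != 0 by rewrite pnatr_eq0 -lt0n fact_gt0.
apply: (mulfI fac0); rewrite mulrCA [in LHS]mulr_sumr -e natrM natr_prod natr_sum.
by field.
Qed.

End Intersections.

Unset Implicit Arguments.

Theorem theorem3p3 (R : realType) (n : nat) (fs : 'I_n -> tpoly R n.+1)
  (d : 'I_n -> nat) :
  (2 <= n)%N ->
  (forall i, smooth_of_degree (fs i) (d i)) ->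
  trop_transversal fs ->
  exists vs : seq 'rV[R]_n.+1,
    uniq vs /\ (forall P, P \in vs <-> cvertex fs P) /\
    (\sum_(P <- vs) imult fs P)%E =
      (((\prod_(i < n) d i) * (\sum_(i < n) d i))%N%:R)%:E.
Proof.
move=> _ smooth trans; apply: sum_imult => // i; by have [] := smooth i.
Qed.
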